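(* Let $m\geq1$ and, for $1\le k\le m$, let $\alpha_k,\gamma_k\in\mathbb{C}$, $\beta_k,\lambda_k\in\mathbb{C}^*$ and $g_k\in\mathbb{C}[t_k]$. The $U(L)$-module $\mathbf{T}(\boldsymbol{\alpha},\boldsymbol{\beta},\boldsymbol{\gamma},\boldsymbol{\lambda},\boldsymbol{g})=\bigotimes_{k=1}^{m}\Omega(\alpha_k,\beta_k,\gamma_k,\lambda_k,g_k)$ is simple if and only if $\lambda_1,\ldots,\lambda_m$ are pairwise distinct non-zero complex numbers.
   Context: $\mathbb{C}^*$ denotes the non-zero complex numbers. $L=\mathcal{W}\ltimes\widehat{H_4}$ is the complex Lie algebra with $\mathbb{C}$-basis $\{L_n,a_n,b_n,c_n,d_n\mid n\in\mathbb{Z}\}$ and non-vanishing brackets $[L_m,L_n]=(n-m)L_{m+n}$, $[L_m,x_n]=n\,x_{m+n}$ for $x\in\{a,b,c,d\}$, $[a_m,b_n]=c_{m+n}$, $[d_m,a_n]=a_{m+n}$, $[d_m,b_n]=-b_{m+n}$ (for $m,n\in\mathbb{Z}$). $U(L)$ is its universal enveloping algebra. For $\alpha,\gamma\in\mathbb{C}$, $\beta,\lambda\in\mathbb{C}^*$ and $g\in\mathbb{C}[t]$, $\Omega(\alpha,\beta,\gamma,\lambda,g)$ is the polynomial space $\mathbb{C}[s,t]$ with the $U(L)$-action given, for $n\in\mathbb{Z}$ and $f(s,t)\in\mathbb{C}[s,t]$, by $$L_n f(s,t)=\lambda^n(s+n\alpha)f(s-n,t),$$ $$d_n f(s,t)=\lambda^n\beta^{-1}\left(tg(t)+\gamma\right)f(s-n,t)+\lambda^n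 t\,\partial_t f(s-n,t),$$ $$a_n f(s,t)=\lambda^n t f(s-n,t),$$ $$b_n f(s,t)=\lambda^n g(t) f(s-n,t)+\lambda^n \beta\, \partial_t f(s-n,t),$$ $$c_n f(s,t)=-\lambda^n\beta f(s-n,t).$$ The $k$-th tensor factor $\Omega(\alpha_k,\beta_k,\gamma_k,\lambda_k,g_k)$ is realized on $\mathbb{C}[s_k,t_k]$ (variables $s_k,t_k$ in place of $s,t$), tensor products are over $\mathbb{C}$, and $L$ acts on the tensor product in the usual way, $x(v_1\otimes\cdots\otimes v_m)=\sum_{k}v_1\otimes\cdots\otimes xv_k\otimes\cdots\otimes v_m$ for $x\in L$. *)

(* Defs.v *)
From HB Require Import structures.
From mathcomp Require Import all_boot all_order all_algebra ring.
From mathcomp Require Import finmap boolp generic_quotient ring_quotient.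
From mathcomp Require Import monalg mpoly.
Set Implicit Arguments. Unset Strict Implicit. Unset Printing Implicit Defensive.
Import Order.TTheory GRing.Theory Num.Theory.
Local Open Scope ring_scope.
Local Open Scope quotient_scope.

(* {malg F[K]} is the free F-module on K; malg_ext f is the linear map with *)
(* << k >> |-> f k.                                                         *)
HB.lock Definition malg_ext (F : fieldType) (K : choiceType) (U : lmodType F)
    (f : K -> U) (u : {malg F[K]}) : U :=
  \sum_(k <- monalg.msupp u) monalg.mcoeff k u *: f k.

Section FreeModule.
Variables (F : fieldType) (K : choiceType).

Lemma malg_extEw (U : lmodType F) (f : K -> U) u (d : {fset K}) :
  (monalg.msupp u `<=` d)%fset -> malg_ext f u = \sum_(k <- d) monalg.mcoeff k u *: f k.
Proof.
move=> le_ud; rewrite malg_ext.unlock (big_fset_incl _ le_ud) //= => k _ /monalg.mcoeff_outdom ->.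
by rewrite scale0r.
Qed.

Lemma malg_ext_linear (U : lmodType F) (f : K -> U) : linear (malg_ext f).
Proof.
move=> a u v.
pose d := (monalg.msupp u `|` monalg.msupp v `|` monalg.msupp (a *: u + v))%fset.
have lu : (monalg.msupp u `<=` d)%fset by rewrite /d -fsetUA fsubsetUl.
have lv : (monalg.msupp v `<=` d)%fset by rewrite /d fsetUAC fsubsetUr.
have lw : (monalg.msupp (a *: u + v) `<=` d)%fset by rewrite /d fsubsetUr.
rewrite (malg_extEw _ lu) (malg_extEw _ lv) (malg_extEw _ lw).
rewrite scaler_sumr -big_split /=; apply: eq_bigr => k _.
by rewrite monalg.mcoeffD monalg.mcoeffZ scalerDl scalerA.
Qed.

HB.instance Definition _ (U : lmodType F) (f : K -> U) :=
  GRing.isLinear.Build F {malg F[K]} U _ (malg_ext f) (malg_ext_linear f).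

Lemma malg_extU (U : lmodType F) (f : K -> U) k : malg_ext f << k >> = f k.
Proof.
by rewrite (malg_extEw _ monalg.msuppU_le) big_seq_fset1 monalg.mcoeffUU scale1r.
Qed.

Lemma malg_genE (u : {malg F[K]}) : u = \sum_(k <- monalg.msupp u) monalg.mcoeff k u *: << k >>.
Proof.
rewrite {1}[u]monalgE; apply: eq_bigr => k _; apply/malgP => j.
by rewrite monalg.mcoeffZ !monalg.mcoeffU; case: (k == j); rewrite ?mulr1 ?mulr0.
Qed.

Lemma malg_ind (P : {malg F[K]} -> Prop) : P 0 ->
  (forall a u v, P u -> P v -> P (a *: u + v)) -> (forall k, P << k >>) ->
  forall u, P u.
Proof.
move=> P0 Pl PU u; rewrite [u]malg_genE.
by elim/big_rec: _ => [|k y _ Py] //; apply: Pl.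
Qed.

End FreeModule.

Section TensorSpace.
Variables (F : fieldType) (m : nat) (V : 'I_m -> lmodType F).
Local Notation fam := {dffun forall k : 'I_m, V k}.

(* v with its component at k replaced by x *)
Definition upd (v : fam) (k : 'I_m) (x : V k) : fam := [ffun j => dfwith v x j].

Lemma updE v k (x : V k) : upd v x k = x.
Proof. by rewrite ffunE dfwith_in. Qed.

Lemma updNE v k (x : V k) j : k != j -> upd v x j = v j.
Proof. by move=> kj; rewrite ffunE dfwith_out. Qed.

Lemma upd_id (v : fam) k : upd v (v k) = v.
Proof.
apply/ffunP => j; have [<-|kj] := eqVneq k j; first by rewrite updE.
by rewrite updNE.
Qed.

Lemma upd_upd v k (x y : V k) : upd (upd v x) y = upd v y.
Proof.
apply/ffunP => j; have [<-|kj] := eqVneq k j; first by rewrite !updE.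
by rewrite !updNE.
Qed.

Lemma updC v k j (x : V k) (y : V j) : k != j ->
  upd (upd v x) y = upd (upd v y) x.
Proof.
move=> kj; apply/ffunP => i.
have [ji|ji] := eqVneq j i; first by subst i; rewrite updE updNE // updE.
rewrite updNE //; have [ki|ki] := eqVneq k i; first by subst i; rewrite !updE.
by rewrite !updNE.
Qed.

Definition multilinear (U : lmodType F) (f : fam -> U) :=
  forall v k a (x y : V k),
    f (upd v (a *: x + y)) = a *: f (upd v x) + f (upd v y).

(* The tensor product V_1 (x) ... (x) V_m is the free vector space on the *)
(* families (v_k)_k, modulo the span of the multilinearity relations.      *)
Inductive tensor_rel : {malg F[fam]} -> Prop :=
| tensor_rel_multilinear v k a (x y : V k) :
    tensor_rel (<< upd v (a *: x + y) >> - (a *: << upd v x >> + << upd v y >>))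
| tensor_rel0 : tensor_rel 0
| tensor_rel_linear a u w :
    tensor_rel u -> tensor_rel w -> tensor_rel (a *: u + w).

Definition tensor_ker : pred {malg F[fam]} := fun u => `[< tensor_rel u >].

Lemma tensor_ker_zmod_closed : zmod_closed tensor_ker.
Proof.
split; first by apply/asboolP; apply: tensor_rel0.
move=> u w /asboolP Hu /asboolP Hw; apply/asboolP.
rewrite -[u - w]addrC -scaleN1r; exact: tensor_rel_linear.
Qed.

HB.instance Definition _ :=
  GRing.isZmodClosed.Build {malg F[fam]} tensor_ker tensor_ker_zmod_closed.

Definition tensor : Type :=
  Quotient.quot (GRing.ZmodClosed.clone {malg F[fam]} tensor_ker _).

HB.instance Definition _ := Choice.on tensor.
HB.instance Definition _ := GRing.Zmodule.on tensor.
HB.instance Definition _ := EqQuotient.on tensor.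
HB.instance Definition _ := ZmodQuotient.on tensor.

Lemma tensor_eqP (u w : {malg F[fam]}) :
  \pi_tensor u = \pi_tensor w <-> tensor_rel (u - w).
Proof.
split=> [/eqP|H]; first by rewrite -Quotient.idealrBE => /asboolP.
by apply/eqP; rewrite -Quotient.idealrBE; apply/asboolP.
Qed.

Lemma tensor_pi_repr (u : {malg F[fam]}) :
  tensor_rel (repr (\pi_tensor u) - u).
Proof. by apply/tensor_eqP; rewrite reprK. Qed.

Lemma tensor_relZ a u : tensor_rel u -> tensor_rel (a *: u).
Proof.
move=> Hu; rewrite -[_ *: _]addr0; apply: tensor_rel_linear => //.
exact: tensor_rel0.
Qed.

Definition tensor_scale (a : F) (t : tensor) : tensor :=
  \pi_tensor (a *: repr t).

Lemma pi_tensor_scale a u : tensor_scale a (\pi_tensor u) = \pi_tensor (a *: u).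
Proof.
by apply/tensor_eqP; rewrite -scalerBr; apply/tensor_relZ/tensor_pi_repr.
Qed.

Lemma tensor_piD u w : \pi_tensor (u + w) = \pi_tensor u + \pi_tensor w.
Proof. by rewrite raddfD. Qed.

Lemma tensor_scaleA a b t :
  tensor_scale a (tensor_scale b t) = tensor_scale (a * b) t.
Proof.
elim/quotW: t => u.
by rewrite (pi_tensor_scale b u) (pi_tensor_scale a) pi_tensor_scale scalerA.
Qed.

Lemma tensor_scale1 : left_id 1 tensor_scale.
Proof. by elim/quotW => u; rewrite (pi_tensor_scale 1 u) scale1r. Qed.

Lemma tensor_scaleDr : right_distributive tensor_scale +%R.
Proof.
move=> a; elim/quotW => u; elim/quotW => w.
by rewrite -tensor_piD (pi_tensor_scale a u) (pi_tensor_scale a w)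
  pi_tensor_scale scalerDr tensor_piD.
Qed.

Lemma tensor_scaleDl t : {morph tensor_scale^~ t : a b / a + b}.
Proof.
elim/quotW: t => u a b.
by rewrite (pi_tensor_scale a u) (pi_tensor_scale b u) pi_tensor_scale scalerDl
  tensor_piD.
Qed.

HB.instance Definition _ := GRing.Zmodule_isLmodule.Build F tensor
  tensor_scaleA tensor_scale1 tensor_scaleDr tensor_scaleDl.

Lemma tensor_piZ a u : \pi_tensor (a *: u) = a *: \pi_tensor u.
Proof. by rewrite -pi_tensor_scale. Qed.

(* v_1 (x) ... (x) v_m *)
Definition pure (v : fam) : tensor := \pi_tensor << v >>.

Lemma pure_multilinear : multilinear pure.
Proof.
move=> v k a x y; rewrite /pure -tensor_piZ -tensor_piD; apply/tensor_eqP.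
exact: tensor_rel_multilinear.
Qed.

Lemma tensor_ind (P : tensor -> Prop) : P 0 ->
  (forall a s t, P s -> P t -> P (a *: s + t)) -> (forall v, P (pure v)) ->
  forall t, P t.
Proof.
move=> P0 Pl Pp; elim/quotW; elim/malg_ind => [|a u w Pu Pw|v].
- by rewrite raddf0.
- by rewrite tensor_piD tensor_piZ; apply: Pl.
- exact: Pp.
Qed.

End TensorSpace.

(* Computed on a representative, hence meaningful only when f is multilinear. *)
HB.lock Definition tensor_lift (F : fieldType) (m : nat)
    (V : 'I_m -> lmodType F) (U : lmodType F)
    (f : {dffun forall k : 'I_m, V k} -> U) (t : tensor V) : U :=
  malg_ext f (repr t).

Section TensorLift.
Variables (F : fieldType) (m : nat) (V : 'I_m -> lmodType F).
Local Notation fam := {dffun forall k : 'I_m, V k}.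
Local Notation tensor := (tensor V).

Lemma tensor_lift_pi (U : lmodType F) (f : fam -> U) : multilinear f ->
  forall u, tensor_lift f (\pi_tensor u) = malg_ext f u.
Proof.
move=> fml u; rewrite tensor_lift.unlock; apply/eqP; rewrite -subr_eq0 -linearB; apply/eqP.
elim: (tensor_pi_repr u) => [v k a x y||a w w' _ IH _ IH'].
- by rewrite linearB linearP /= !malg_extU fml subrr.
- exact: linear0.
- by rewrite linearP IH IH' /= scaler0 addr0.
Qed.

Lemma tensor_lift_linear (U : lmodType F) (f : fam -> U) :
  multilinear f -> linear (tensor_lift f).
Proof.
move=> fml a; elim/quotW => u; elim/quotW => w.
by rewrite -tensor_piZ -tensor_piD !tensor_lift_pi // linearP.
Qed.

Lemma tensor_lift_pure (U : lmodType F) (f : fam -> U) : multilinear f ->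
  forall v, tensor_lift f (pure v) = f v.
Proof. by move=> fml v; rewrite tensor_lift_pi // malg_extU. Qed.

End TensorLift.

HB.mixin Record Lmodule_isLieAlgebra (F : fieldType) L of GRing.Lmodule F L := {
  bracket : L -> L -> L;
  bracket_linearl : forall y, linear (bracket^~ y);
  bracket_linearr : forall x, linear (bracket x);
  bracketxx : forall x, bracket x x = 0;
  jacobi : forall x y z,
    bracket x (bracket y z) + bracket y (bracket z x)
      + bracket z (bracket x y) = 0
}.

#[short(type="lieAlgType")]
HB.structure Definition LieAlgebra (F : fieldType) :=
  {L of GRing.Lmodule F L & Lmodule_isLieAlgebra F L}.

HB.mixin Record Lmodule_isLieModule (F : fieldType) (L : lieAlgType F) V
    of GRing.Lmodule F V := {
  lact : L -> V -> V;
  lact_linearl : forall v, linear (lact^~ v);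
  lact_linearr : forall x, linear (lact x);
  lact_bracket : forall x y v,
    lact (bracket x y) v = lact x (lact y v) - lact y (lact x v)
}.

(* Modules over L, i.e. over its enveloping algebra U(L): the action of U(L) is *)
(* determined by that of L, and a subspace is stable under U(L) iff it is      *)
(* stable under L.                                                             *)
#[short(type="lieModType")]
HB.structure Definition LieModule (F : fieldType) (L : lieAlgType F) :=
  {V of GRing.Lmodule F V & Lmodule_isLieModule F L V}.

Section LieModule.
Variables (F : fieldType) (L : lieAlgType F).

Definition submodule (V : lieModType L) (W : V -> Prop) : Prop :=
  [/\ W 0, forall a v w, W v -> W w -> W (a *: v + w)
    & forall (x : L) v, W v -> W (lact x v)].

Definition simple_module (V : lieModType L) : Prop :=
  (exists v : V, v != 0) /\
  forall W : V -> Prop, submodule W ->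
    (forall v, W v -> v = 0) \/ (forall v, W v).

Section Theory.
Variable V : lieModType L.
HB.instance Definition _ (x : L) :=
  GRing.isLinear.Build F V V _ (@lact F L V x) (lact_linearr x).
End Theory.

End LieModule.

(* The laws of the diagonal action, over any space T spanned by the values of *)
(* a multilinear map p.                                                      *)
Section DiagonalAction.
Variables (F : fieldType) (L : lieAlgType F) (m : nat) (V : 'I_m -> lieModType L).
Local Notation fam := {dffun forall k : 'I_m, V k}.
Variables (T : lmodType F) (p : fam -> T).
Hypothesis p_multilinear : forall (v : fam) k a (y z : V k),
  p (upd v (a *: y + z)) = a *: p (upd v y) + p (upd v z).
Hypothesis p_ind : forall P : T -> Prop, P 0 ->
  (forall a s t, P s -> P t -> P (a *: s + t)) -> (forall v, P (p v)) ->
  forall t, P t.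

Definition leibniz (x : L) (v : fam) : T := \sum_k p (upd v (lact x (v k))).

Lemma leibniz_multilinear x (v : fam) k a (y z : V k) :
  leibniz x (upd v (a *: y + z))
    = a *: leibniz x (upd v y) + leibniz x (upd v z).
Proof.
rewrite /leibniz scaler_sumr -big_split /=; apply: eq_bigr => j _.
have [<-|kj] := eqVneq k j.
  by rewrite !updE !upd_upd linearP p_multilinear.
by rewrite !updNE // !(updC _ _ _ kj) p_multilinear.
Qed.

Variable act : L -> T -> T.
Hypothesis act_linear : forall x a s t, act x (a *: s + t) = a *: act x s + act x t.
Hypothesis act_p : forall x v, act x (p v) = leibniz x v.

Let act0 x : act x 0 = 0.
Proof. by have := act_linear x (-1) 0 0; rewrite addr0 !scaleN1r oppr0 addNr. Qed.

Let act_sum x (s : 'I_m -> T) : act x (\sum_k s k) = \sum_k act x (s k).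
Proof.
apply: (big_morph _ _ (act0 x)) => y z.
by rewrite -[y in LHS]scale1r act_linear scale1r.
Qed.

Lemma diagonal_linearl t a x y : act (a *: x + y) t = a *: act x t + act y t.
Proof.
elim/p_ind: t => [|b s t IHs IHt|v].
- by rewrite !act0 scaler0 addr0.
- by rewrite !act_linear IHs IHt !scalerDr !scalerA [b * a]mulrC addrACA.
- rewrite !act_p /leibniz scaler_sumr -big_split /=; apply: eq_bigr => k _.
  by rewrite lact_linearl p_multilinear.
Qed.

Lemma diagonal_bracket x y t :
  act (bracket x y) t = act x (act y t) - act y (act x t).
Proof.
elim/p_ind: t => [|b s t IHs IHt|v]; first by rewrite !act0 subrr.
  by rewrite !act_linear IHs IHt scalerBr opprD addrACA.
rewrite !act_p /leibniz !act_sum.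
have E z w : \sum_k act z (p (upd v (lact w (v k)))) =
   \sum_k p (upd v (lact z (lact w (v k)))) +
   \sum_k \sum_(j | j != k) p (upd (upd v (lact w (v k))) (lact z (v j))).
  rewrite -big_split /=; apply: eq_bigr => k _.
  rewrite act_p /leibniz (bigD1 k) //= updE upd_upd; congr (_ + _).
  by apply: eq_bigr => j jk; rewrite updNE // eq_sym.
rewrite !E [X in _ - (_ + X)](exchange_big_dep xpredT) //=.
have -> : \sum_j \sum_(i | j != i) p (upd (upd v (lact x (v i))) (lact y (v j)))
   = \sum_k \sum_(j | j != k) p (upd (upd v (lact y (v k))) (lact x (v j))).
  apply: eq_bigr => k _; apply: eq_big => j; rewrite eq_sym // => kj.
  by rewrite updC.
rewrite opprD addrACA subrr addr0 -sumrB; apply: eq_bigr => k _.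
by rewrite lact_bracket addrC -scaleN1r p_multilinear scaleN1r addrC.
Qed.

End DiagonalAction.

Section TensorModule.
Variables (F : fieldType) (L : lieAlgType F) (m : nat) (V : 'I_m -> lieModType L).
Local Notation fam := {dffun forall k : 'I_m, V k}.

Definition tensor_module : Type := tensor (fun k => V k : lmodType F).

HB.instance Definition _ :=
  GRing.Lmodule.copy tensor_module (tensor (fun k => V k : lmodType F)).

Definition tmod_pure (v : fam) : tensor_module := pure v.

(* x (v_1 (x) ... (x) v_m) = sum_k v_1 (x) ... (x) x v_k (x) ... (x) v_m *)
Definition tensor_act (x : L) : tensor_module -> tensor_module :=
  tensor_lift (fun v => \sum_k tmod_pure (upd v (lact x (v k)))).

Lemma tmod_pure_multilinear (v : fam) k a (y z : V k) :
  tmod_pure (upd v (a *: y + z)) =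
    a *: tmod_pure (upd v y) + tmod_pure (upd v z).
Proof. exact: pure_multilinear. Qed.

Lemma tmod_ind (P : tensor_module -> Prop) : P 0 ->
  (forall a s t, P s -> P t -> P (a *: s + t)) -> (forall v, P (tmod_pure v)) ->
  forall t, P t.
Proof. exact: tensor_ind. Qed.

Lemma tensor_act_pure x (v : fam) :
  tensor_act x (tmod_pure v) = \sum_k tmod_pure (upd v (lact x (v k))).
Proof. exact/tensor_lift_pure/(leibniz_multilinear tmod_pure_multilinear). Qed.

Lemma tensor_act_linearr x : linear (tensor_act x).
Proof. exact/tensor_lift_linear/(leibniz_multilinear tmod_pure_multilinear). Qed.

Lemma tensor_act_linearl t : linear (tensor_act^~ t).
Proof.
exact: (diagonal_linearl tmod_pure_multilinear tmod_ind tensor_act_linearr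
  tensor_act_pure).
Qed.

Lemma tensor_act_bracket x y t :
  tensor_act (bracket x y) t
    = tensor_act x (tensor_act y t) - tensor_act y (tensor_act x t).
Proof.
exact: (diagonal_bracket tmod_pure_multilinear tmod_ind tensor_act_linearr
  tensor_act_pure).
Qed.

HB.instance Definition _ :=
  Lmodule_isLieModule.Build F L tensor_module
    tensor_act_linearl tensor_act_linearr tensor_act_bracket.

End TensorModule.

(* (gL, n), (ga, n), (gb, n), (gc, n), (gd, n) index the basis vectors *)
(* L_n, a_n, b_n, c_n, d_n of the Lie algebra WH4.                      *)

Inductive WH4_gen := gL | ga | gb | gc | gd.

Definition nat_of_WH4_gen x :=
  match x with gL => 0 | ga => 1 | gb => 2 | gc => 3 | gd => 4 end%N.
Definition WH4_gen_of_nat n :=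
  match n with 0 => gL | 1 => ga | 2 => gb | 3 => gc | _ => gd end%N.
Lemma nat_of_WH4_genK : cancel nat_of_WH4_gen WH4_gen_of_nat.
Proof. by case. Qed.
HB.instance Definition _ := Countable.copy WH4_gen (can_type nat_of_WH4_genK).

Lemma malg_ext_fun_linear (F : fieldType) (K : choiceType) (U : lmodType F) a
    (f g : K -> U) u :
  malg_ext (fun k => a *: f k + g k) u = a *: malg_ext f u + malg_ext g u.
Proof.
rewrite malg_ext.unlock scaler_sumr -big_split /=; apply: eq_bigr => k _.
by rewrite scalerDr !scalerA mulrC.
Qed.

Section WH4.
Variable C : numFieldType.

(* The bracket of e x m and e y n, for e a family of vectors indexed like the *)
(* basis of L.                                                               *)
Definition WH4_table (T : lmodType C) (e : WH4_gen -> int -> T)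
    (x : WH4_gen) (m : int) (y : WH4_gen) (n : int) : T :=
  match x, y with
  | gL, gL => (n - m)%:~R *: e gL (m + n)
  | gL, _ => n%:~R *: e y (m + n)
  | _, gL => - (m%:~R *: e x (m + n))
  | ga, gb => e gc (m + n)
  | gb, ga => - e gc (m + n)
  | gd, ga => e ga (m + n)
  | ga, gd => - e ga (m + n)
  | gd, gb => - e gb (m + n)
  | gb, gd => e gb (m + n)
  | _, _ => 0
  end.

Lemma WH4_tableC (T : lmodType C) (e : WH4_gen -> int -> T) x m y n :
  WH4_table e x m y n = - WH4_table e y n x m.
Proof.
case: x; case: y; rewrite /= ?oppr0 ?opprK ?[n + m]addrC //.
by rewrite -scaleNr -mulrNz opprB.
Qed.

Lemma WH4_table_jacobi (T : lmodType C) (e : WH4_gen -> int -> T)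
    (br : T -> T -> T) x l y m z n :
  (forall x m y n, br (e x m) (e y n) = WH4_table e x m y n) ->
  (forall u v, br v (- u) = - br v u) ->
  (forall a u v, br v (a *: u) = a *: br v u) -> (forall v, br v 0 = 0) ->
  br (e x l) (br (e y m) (e z n)) + br (e y m) (br (e z n) (e x l))
    + br (e z n) (br (e x l) (e y m)) = 0.
Proof.
move=> brE brN brZ br0.
have [E1 E2] : m + (n + l) = l + (m + n) /\ n + (l + m) = l + (m + n).
  by split; ring.
case: x; case: y; case: z; rewrite !brE /= ?(brN, brZ, br0) ?brE /=
  ?E1 ?E2 ?oppr0 ?scaler0 ?addr0 ?add0r ?oppr0 //.
all: move: (e _ _) => v; rewrite -[v]scale1r ?scalerN ?scalerA ?opprK.
all: rewrite -?scaleNr -?scalerDl -[RHS](scale0r v); congr (_ *: _); ring.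
Qed.

Definition WH4 : Type := {malg C[(WH4_gen * int)%type]}.
HB.instance Definition _ := GRing.Lmodule.on WH4.

Definition wb (x : WH4_gen) (n : int) : WH4 := << (x, n) >>.

Definition WH4_basis_bracket (p q : WH4_gen * int) : WH4 :=
  WH4_table wb p.1 p.2 q.1 q.2.

Definition WH4_bracket (u v : WH4) : WH4 :=
  malg_ext (fun p => malg_ext (WH4_basis_bracket p) v) u.

Lemma WH4_ind (P : WH4 -> Prop) : P 0 ->
  (forall a u v, P u -> P v -> P (a *: u + v)) -> (forall x n, P (wb x n)) ->
  forall u, P u.
Proof. by move=> P0 Pl PU; apply: malg_ind => // -[x n]; apply: PU. Qed.

Lemma WH4_bracketE x m y n :
  WH4_bracket (wb x m) (wb y n) = WH4_table wb x m y n.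
Proof. by rewrite /WH4_bracket !malg_extU. Qed.

Lemma WH4_bracket_linearl v : linear (WH4_bracket^~ v).
Proof. exact: malg_ext_linear. Qed.

Lemma WH4_bracket_linearr u : linear (WH4_bracket u).
Proof.
move=> a v w; rewrite /WH4_bracket -malg_ext_fun_linear.
by congr (malg_ext _ _); apply/funext => p; rewrite linearP.
Qed.

Lemma WH4_bracket0l v : WH4_bracket 0 v = 0.
Proof.
by have := WH4_bracket_linearl v (-1) 0 0; rewrite addr0 !scaleN1r oppr0 addNr.
Qed.

Lemma WH4_bracket0r u : WH4_bracket u 0 = 0.
Proof.
by have := WH4_bracket_linearr u (-1) 0 0; rewrite addr0 !scaleN1r oppr0 addNr.
Qed.

Lemma WH4_bracketZl a u v : WH4_bracket (a *: u) v = a *: WH4_bracket u v.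
Proof.
by have := WH4_bracket_linearl v a u 0; rewrite WH4_bracket0l !addr0.
Qed.

Lemma WH4_bracketZr a u v : WH4_bracket v (a *: u) = a *: WH4_bracket v u.
Proof.
by have := WH4_bracket_linearr v a u 0; rewrite WH4_bracket0r !addr0.
Qed.

Lemma WH4_bracketNl u v : WH4_bracket (- u) v = - WH4_bracket u v.
Proof. by rewrite -scaleN1r WH4_bracketZl scaleN1r. Qed.

Lemma WH4_bracketNr u v : WH4_bracket v (- u) = - WH4_bracket v u.
Proof. by rewrite -scaleN1r WH4_bracketZr scaleN1r. Qed.

Lemma WH4_bracketC u v : WH4_bracket u v = - WH4_bracket v u.
Proof.
elim/WH4_ind: u => [|a u w IHu IHw|x m].
- by rewrite WH4_bracket0l WH4_bracket0r oppr0.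
- by rewrite WH4_bracket_linearl WH4_bracket_linearr IHu IHw opprD scalerN.
elim/WH4_ind: v => [|a u w IHu IHw|y n].
- by rewrite WH4_bracket0l WH4_bracket0r oppr0.
- by rewrite WH4_bracket_linearl WH4_bracket_linearr IHu IHw opprD scalerN.
by rewrite !WH4_bracketE WH4_tableC.
Qed.

Lemma WH4_bracketxx u : WH4_bracket u u = 0.
Proof.
have /eqP := WH4_bracketC u u; rewrite -subr_eq0 opprK -mulr2n -scaler_nat.
by rewrite scaler_eq0 pnatr_eq0 /= => /eqP.
Qed.

Definition WH4_jacobi_at u v w :=
  WH4_bracket u (WH4_bracket v w) + WH4_bracket v (WH4_bracket w u)
    + WH4_bracket w (WH4_bracket u v).

Lemma WH4_jacobi_atC u v w : WH4_jacobi_at u v w = WH4_jacobi_at v w u.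
Proof. by rewrite /WH4_jacobi_at -addrA addrC. Qed.

Lemma WH4_jacobi_at_linear v w : linear (fun u => WH4_jacobi_at u v w).
Proof.
move=> a x y; rewrite /WH4_jacobi_at !(WH4_bracket_linearl, WH4_bracket_linearr).
by rewrite !scalerDr [X in X + (_ + _) = _]addrACA [LHS]addrACA.
Qed.

Lemma WH4_jacobi_at0 v w : WH4_jacobi_at 0 v w = 0.
Proof. by rewrite /WH4_jacobi_at !(WH4_bracket0l, WH4_bracket0r) !addr0. Qed.

Lemma WH4_jacobi_ind v w :
  (forall x n, WH4_jacobi_at (wb x n) v w = 0) ->
  forall u, WH4_jacobi_at u v w = 0.
Proof.
move=> H; elim/WH4_ind => [|a x y Hx Hy|//]; first exact: WH4_jacobi_at0.
by rewrite WH4_jacobi_at_linear Hx Hy scaler0 addr0.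
Qed.

Lemma WH4_jacobi u v w :
  WH4_bracket u (WH4_bracket v w) + WH4_bracket v (WH4_bracket w u)
    + WH4_bracket w (WH4_bracket u v) = 0.
Proof.
rewrite -/(WH4_jacobi_at u v w).
apply: WH4_jacobi_ind u => x l; rewrite WH4_jacobi_atC.
apply: WH4_jacobi_ind v => y m; rewrite WH4_jacobi_atC.
apply: WH4_jacobi_ind w => z n; rewrite /WH4_jacobi_at.
exact: (WH4_table_jacobi z n x l y m WH4_bracketE WH4_bracketNr WH4_bracketZr
  WH4_bracket0r).
Qed.

HB.instance Definition _ :=
  Lmodule_isLieAlgebra.Build C WH4
    WH4_bracket_linearl WH4_bracket_linearr WH4_bracketxx WH4_jacobi.

End WH4.

Section WH4Action.
Variables (C : numFieldType) (V : lmodType C) (op : WH4_gen -> int -> V -> V).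

(* The linear extension to L of an action of its basis. *)
Definition WH4_act (u : WH4 C) (v : V) : V :=
  malg_ext (fun p : (WH4_gen * int)%type => op p.1 p.2 v) u.

Lemma WH4_act_wb x n v : WH4_act (wb C x n) v = op x n v.
Proof. by rewrite /WH4_act malg_extU. Qed.

Lemma WH4_act_linearl v : linear (WH4_act^~ v).
Proof. exact: malg_ext_linear. Qed.

Hypothesis op_linear : forall x n a v w, op x n (a *: v + w) = a *: op x n v + op x n w.

Lemma WH4_act_linearr u : linear (WH4_act u).
Proof.
move=> a v w; rewrite /WH4_act -malg_ext_fun_linear.
by congr (malg_ext _ _); apply/funext => p; rewrite op_linear.
Qed.

Hypothesis op_bracket : forall x m y n v,
  op x m (op y n v) - op y n (op x m v) = WH4_table (fun z k => op z k v) x m y n.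

Lemma WH4_act_table (x : WH4_gen) m y n v :
  WH4_act (WH4_table (wb C) x m y n) v = WH4_table (fun z k => op z k v) x m y n.
Proof.
pose f u := WH4_act u v.
have f0 : f 0 = 0.
  have : f ((-1) *: 0 + 0) = (-1) *: f 0 + f 0 by apply: WH4_act_linearl.
  by rewrite addr0 scaler0 scaleN1r addNr.
have fZ a u : f (a *: u) = a *: f u.
  have : f (a *: u + 0) = a *: f u + f 0 by apply: WH4_act_linearl.
  by rewrite addr0 f0 addr0.
have fN u : f (- u) = - f u by rewrite -[- u]scaleN1r fZ scaleN1r.
have fE z k : f (wb C z k) = op z k v by apply: WH4_act_wb.
rewrite -/(f _); move: f f0 fZ fN fE => f f0 fZ fN fE.
by case: x; case: y; rewrite /= ?(fN, fZ) ?fE ?f0.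
Qed.

Lemma WH4_linear_ext (f h : WH4 C -> V) :
  (forall a u w, f (a *: u + w) = a *: f u + f w) ->
  (forall a u w, h (a *: u + w) = a *: h u + h w) ->
  (forall x n, f (wb C x n) = h (wb C x n)) -> forall u, f u = h u.
Proof.
move=> fl hl fh; elim/WH4_ind => [|a u w IHu IHw|//]; last by rewrite fl hl IHu IHw.
have := fl (-1) 0 0; have := hl (-1) 0 0.
by rewrite addr0 scaler0 !scaleN1r !addNr => -> ->.
Qed.

Lemma WH4_act_bracket (u w : WH4 C) v :
  WH4_act (bracket u w) v = WH4_act u (WH4_act w v) - WH4_act w (WH4_act u v).
Proof.
pose f := WH4_act.
have fl a x y z : f (a *: x + y) z = a *: f x z + f y z by apply: WH4_act_linearl.
have fr a x y z : f z (a *: x + y) = a *: f z x + f z y by apply: WH4_act_linearr.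
have fE x n z : f (wb C x n) z = op x n z by apply: WH4_act_wb.
have ft x m y n z : f (WH4_table (wb C) x m y n) z
  = WH4_table (fun z' k => op z' k z) x m y n by apply: WH4_act_table.
rewrite -/f; move: f fl fr fE ft => f fl fr fE ft.
pose h1 u := f (bracket u w) v; pose h2 u := f u (f w v) - f w (f u v).
apply: (@WH4_linear_ext h1 h2) u => [a x y|a x y|x m]; rewrite /h1 /h2 {h1 h2}.
- by rewrite bracket_linearl fl.
- by rewrite !fl fr scalerBr opprD addrACA.
pose k1 w := f (bracket (wb C x m) w) v.
pose k2 w := f (wb C x m) (f w v) - f w (f (wb C x m) v).
apply: (@WH4_linear_ext k1 k2) w => [a y z|a y z|y n]; rewrite /k1 /k2.
- by rewrite bracket_linearr fl.
- by rewrite !fl fr scalerBr opprD addrACA.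
rewrite !fE op_bracket -ft; congr (f _ v); exact: WH4_bracketE.
Qed.

End WH4Action.

Section AbstractOmega.
Variables (C : numFieldType) (P : comAlgType C).
Variables (s t G al b Q : P) (e : int -> P) (S : int -> P -> P) (D : P -> P).

Definition abstract_omega_op (x : WH4_gen) (n : int) (f : P) : P :=
  match x with
  | gL => e n * ((s + n%:~R * al) * S n f)
  | gd => e n * (Q * S n f) + e n * (t * D (S n f))
  | ga => e n * (t * S n f)
  | gb => e n * (G * S n f) + e n * b * D (S n f)
  | gc => - (e n * b * S n f)
  end.

Lemma abstract_omega_op_linear :
  (forall n a p q, S n (a *: p + q) = a *: S n p + S n q) ->
  (forall a p q, D (a *: p + q) = a *: D p + D q) ->
  forall x n a p q, abstract_omega_op x n (a *: p + q)
    = a *: abstract_omega_op x n p + abstract_omega_op x n q.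
Proof.
move=> SL DL x n a p q.
have [A aE] : exists A : P, forall f, a *: f = A * f.
  by exists a%:A => f; rewrite mulr_algl.
by case: x; rewrite /= SL ?DL !aE; ring.
Qed.

Hypothesis eD : forall m n, e (m + n) = e m * e n.
Hypothesis SB : forall n p q, S n (p - q) = S n p - S n q.
Hypothesis SM : forall n p q, S n (p * q) = S n p * S n q.
Hypothesis SS : forall m n p, S m (S n p) = S (m + n) p.
Hypothesis Ss : forall n, S n s = s - n%:~R.
Hypothesis St : forall n, S n t = t.
Hypothesis SG : forall n, S n G = G.
Hypothesis SQ : forall n, S n Q = Q.
Hypothesis Sal : forall n, S n al = al.
Hypothesis Sb : forall n, S n b = b.
Hypothesis S1 : forall n, S n 1 = 1.
Hypothesis Se : forall m n, S m (e n) = e n.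
Hypothesis DB : forall p q, D (p - q) = D p - D q.
Hypothesis DM : forall p q, D (p * q) = D p * q + p * D q.
Hypothesis DS : forall n p, D (S n p) = S n (D p).
Hypothesis Ds : D s = 0.
Hypothesis Dt : D t = 1.
Hypothesis De : forall n, D (e n) = 0.
Hypothesis Dal : D al = 0.
Hypothesis Db : D b = 0.
(* Q = (t G + gamma) / b *)
Hypothesis GE : G = b * D Q - t * D G.

Let S0 n : S n 0 = 0. Proof. by rewrite -[in LHS](subrr 0) SB subrr. Qed.
Let SN n p : S n (- p) = - S n p. Proof. by rewrite -[- p]sub0r SB S0 sub0r. Qed.
Let SD n p q : S n (p + q) = S n p + S n q.
Proof. by rewrite -[q]opprK SB SN !opprK. Qed.
Let Snat n (k : nat) : S n k%:R = k%:R.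
Proof. by elim: k => [|k IH]; rewrite ?S0 // -natr1 SD IH S1. Qed.
Let Sint n (k : int) : S n k%:~R = k%:~R.
Proof. by case: k => k; rewrite ?NegzE ?mulrNz ?SN -!pmulrn Snat. Qed.
Let D0 : D 0 = 0. Proof. by rewrite -[in LHS](subrr 0) DB subrr. Qed.
Let DN p : D (- p) = - D p. Proof. by rewrite -[- p]sub0r DB D0 sub0r. Qed.
Let DD p q : D (p + q) = D p + D q.
Proof. by rewrite -[q]opprK DB DN !opprK. Qed.
Let D1 : D 1 = 0.
Proof. by have /eqP := DM 1 1; rewrite !mul1r mulr1 -subr_eq subrr eq_sym => /eqP. Qed.
Let Dnat (k : nat) : D k%:R = 0.
Proof. by elim: k => [|k IH]; rewrite ?D0 // -natr1 DD IH D1 addr0. Qed.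
Let Dint (k : int) : D k%:~R = 0.
Proof. by case: k => k; rewrite ?NegzE ?mulrNz ?DN -!pmulrn Dnat ?oppr0. Qed.

Lemma abstract_omega_bracket x m y n f :
  abstract_omega_op x m (abstract_omega_op y n f)
    - abstract_omega_op y n (abstract_omega_op x m f)
  = WH4_table (fun z k => abstract_omega_op z k f) x m y n.
Proof.
have kE (a : int) (p : P) : (a%:~R : C) *: p = a%:~R * p.
  by rewrite scaler_int mulrzl.
have SDG k : S k (D G) = D G by rewrite -DS SG.
have SDQ k : S k (D Q) = D Q by rewrite -DS SQ.
case: x; case: y; rewrite /= ?kE ?eD ?[n + m]addrC.
all: rewrite ?(SN, SD, SM, Ss, St, SG, SQ, Sal, Sb, S1, Se, Sint, SS).
all: rewrite ?(DN, DD, DM, DS, Ds, Dt, De, Dal, Db, Dint).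
all: rewrite ?(S0, SN, SD, SM, Ss, St, SG, SQ, SDG, SDQ, Sal, Sb, S1, Se, Sint).
all: rewrite ?SS ?[n + m]addrC.
all: move: (S (m + n) f) (S (m + n) (D f)) (S (m + n) (D (D f))) => F1 F2 F3.
all: have := GE; move: (D G) (D Q) => G' Q' gE; rewrite ?gE; clear gE.
all: move: (e m) (e n) => em en.
all: ring.
Qed.

End AbstractOmega.

Section Omega.
Variable C : numFieldType.
(* C[s, t]; the notation for mpoly is shadowed by that of monalg in type_scope *)
Local Notation P := (mpoly 2 C).

Definition var_s : P := 'X_ord0.
Definition var_t : P := 'X_ord_max.

(* f(s - n, t) *)
Definition shift (n : int) (f : P) : P :=
  f \mPo [tuple var_s - (n%:~R)%:MP; var_t].

Definition partial_t (f : P) : P := f^`M(ord_max).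

(* g(t) *)
Definition poly_t (g : {poly C}) : P := (map_poly (@mpolyC 2 C) g).[var_t].

Definition omega_op (alpha beta gamma lambda : C) (g : {poly C})
    (x : WH4_gen) (n : int) (f : P) : P :=
  match x with
  | gL => lambda ^ n *: ((var_s + (n%:~R * alpha)%:MP) * shift n f)
  | gd => (lambda ^ n * beta^-1) *:
            ((var_t * poly_t g + gamma%:MP) * shift n f)
          + lambda ^ n *: (var_t * partial_t (shift n f))
  | ga => lambda ^ n *: (var_t * shift n f)
  | gb => lambda ^ n *: (poly_t g * shift n f)
          + (lambda ^ n * beta) *: partial_t (shift n f)
  | gc => - ((lambda ^ n * beta) *: shift n f)
  end.

Lemma mpoly_alg_ind (Q : P -> Prop) : (forall c, Q c%:MP) -> (forall i, Q 'X_i) ->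
  (forall p q, Q p -> Q q -> Q (p + q)) -> (forall p q, Q p -> Q q -> Q (p * q)) ->
  forall p, Q p.
Proof.
move=> QC QX QD QM p; have Q0 : Q 0 by rewrite -mpolyC0.
rewrite [p]mpolyE; elim/big_rec: _ => // m q _ Qq; apply: (QD) => //.
rewrite -mul_mpolyC; apply: (QM) => //; rewrite mpolyXE_id.
elim/big_rec: _ => [|i r _ Qr]; first by rewrite -mpolyC1.
apply: (QM) => //; elim: (m i) => [|k IH]; first by rewrite expr0 -mpolyC1.
by rewrite exprS; apply: (QM).
Qed.

Lemma shiftD n : {morph shift n : p q / p + q}.
Proof. by move=> p q; rewrite /shift raddfD. Qed.
Lemma shiftB n : {morph shift n : p q / p - q}.
Proof. by move=> p q; rewrite /shift raddfB. Qed.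
Lemma shiftM n : {morph shift n : p q / p * q}.
Proof. by move=> p q; rewrite /shift rmorphM. Qed.
Lemma shiftC n c : shift n c%:MP = c%:MP.
Proof. exact: comp_mpolyC. Qed.
Lemma shift_s n : shift n var_s = var_s - (n%:~R)%:MP.
Proof. by rewrite /shift comp_mpolyXU. Qed.
Lemma shift_t n : shift n var_t = var_t.
Proof. by rewrite /shift comp_mpolyXU. Qed.
Lemma shift_poly_t n g : shift n (poly_t g) = poly_t g.
Proof.
rewrite /poly_t; elim/poly_ind: g => [|g c IH].
  by rewrite rmorph0 horner0 -mpolyC0 shiftC.
rewrite rmorphD rmorphM /= map_polyX map_polyC hornerMXaddC.
by rewrite shiftD shiftM IH shift_t shiftC.
Qed.
Lemma mpoly2_ind (Q : P -> Prop) : (forall c, Q c%:MP) -> Q var_s -> Q var_t ->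
  (forall p q, Q p -> Q q -> Q (p + q)) -> (forall p q, Q p -> Q q -> Q (p * q)) ->
  forall p, Q p.
Proof.
move=> QC Qs Qt QD QM; apply: mpoly_alg_ind => // i.
by case: (unliftP ord_max i) => [j ->|->] //; rewrite (ord1 j) (_ : lift _ _ = ord0) //;
  apply/val_inj.
Qed.

Lemma shift_shift m n p : shift m (shift n p) = shift (m + n) p.
Proof.
elim/mpoly2_ind: p => [c|||p q IHp IHq|p q IHp IHq].
- by rewrite !shiftC.
- by rewrite !shift_s shiftB shift_s shiftC intrD mpolyCD opprD addrA.
- by rewrite !shift_t.
- by rewrite !shiftD IHp IHq.
- by rewrite !shiftM IHp IHq.
Qed.

Lemma partial_tD : {morph partial_t : p q / p + q}.
Proof. by move=> p q; rewrite /partial_t raddfD. Qed.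
Lemma partial_tB : {morph partial_t : p q / p - q}.
Proof. by move=> p q; rewrite /partial_t raddfB. Qed.
Lemma partial_tM p q : partial_t (p * q) = partial_t p * q + p * partial_t q.
Proof. exact: mderivM. Qed.
Lemma partial_tC c : partial_t c%:MP = 0.
Proof. exact: mderivC. Qed.
Lemma partial_t_s : partial_t var_s = 0.
Proof. by rewrite /partial_t /var_s mderivX mnm1E /= scale0r. Qed.
Lemma partial_t_t : partial_t var_t = 1.
Proof.
rewrite /partial_t /var_t mderivX mnm1E eqxx scale1r -mpolyX0; congr mpolyX.
by apply/mnmP => i; rewrite mnmBE mnm0E subnn.
Qed.

Lemma partial_t_shift n p : partial_t (shift n p) = shift n (partial_t p).
Proof.
elim/mpoly2_ind: p => [c|||p q IHp IHq|p q IHp IHq].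
- by rewrite shiftC partial_tC -mpolyC0 shiftC.
- by rewrite shift_s partial_tB partial_tC partial_t_s subr0 -mpolyC0 shiftC.
- by rewrite shift_t partial_t_t -mpolyC1 shiftC.
- by rewrite shiftD !partial_tD IHp IHq shiftD.
- by rewrite shiftM !partial_tM IHp IHq shiftD !shiftM.
Qed.

Variables (alpha beta gamma lambda : C) (g : {poly C}).
Local Notation op := (omega_op alpha beta gamma lambda g).

Let e n : P := (lambda ^ n)%:MP.
Let Q : P := (beta^-1)%:MP * (var_t * poly_t g + gamma%:MP).

Let omega_opE x n f : op x n f =
  abstract_omega_op var_s var_t (poly_t g) alpha%:MP beta%:MP Q e shift partial_t x n f.
Proof.
rewrite /e /Q; case: x; rewrite /= -?mul_mpolyC ?mpolyCD ?mpolyCM ?rmorph_int //.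
- by rewrite !mulrA.
Qed.

Let opE : op = abstract_omega_op var_s var_t (poly_t g) alpha%:MP beta%:MP Q e
  shift partial_t.
Proof.
by apply/funext => z; apply/funext => k; apply/funext => p; apply: omega_opE.
Qed.

Lemma omega_op_linear x n a p q : op x n (a *: p + q) = a *: op x n p + op x n q.
Proof.
rewrite opE; apply: abstract_omega_op_linear => [k c f h|c f h].
- by rewrite -!mul_mpolyC shiftD shiftM shiftC.
- by rewrite -!mul_mpolyC partial_tD partial_tM partial_tC mul0r add0r.
Qed.

Hypothesis hbeta : beta != 0.
Hypothesis hlambda : lambda != 0.

Lemma omega_op_bracket x m y n f :
  op x m (op y n f) - op y n (op x m f) = WH4_table (fun z k => op z k f) x m y n.
Proof.
rewrite opE; apply: (@abstract_omega_bracket C P).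
- by move=> i j; rewrite /e expfzDr // mpolyCM.
- by move=> i p q; rewrite shiftB.
- by move=> i p q; rewrite shiftM.
- by move=> i j p; rewrite shift_shift.
- by move=> i; rewrite shift_s rmorph_int.
- exact: shift_t.
- by move=> i; rewrite shift_poly_t.
- by move=> i; rewrite /Q !(shiftM, shiftD, shiftC) shift_t shift_poly_t.
- by move=> i; rewrite shiftC.
- by move=> i; rewrite shiftC.
- by move=> i; rewrite -mpolyC1 shiftC.
- by move=> i j; rewrite /e shiftC.
- by move=> p q; rewrite partial_tB.
- by move=> p q; rewrite partial_tM.
- by move=> i p; rewrite partial_t_shift.
- exact: partial_t_s.
- exact: partial_t_t.
- by move=> i; rewrite /e partial_tC.
- exact: partial_tC.
- exact: partial_tC.
- rewrite /Q partial_tM partial_tC mul0r add0r partial_tD partial_tC addr0.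
  rewrite partial_tM partial_t_t mul1r mulrA -mpolyCM divff // mpolyC1 mul1r.
  by rewrite addrK.
Qed.

End Omega.

(* The carrier is C[s, t]; the parameters select the action of WH4. *)
Definition omega (C : numFieldType) (alpha beta gamma lambda : C) (g : {poly C})
  (hbeta : beta != 0) (hlambda : lambda != 0) : Type := mpoly 2 C.

Section OmegaModule.
Variables (C : numFieldType) (alpha beta gamma lambda : C) (g : {poly C}).
Variables (hbeta : beta != 0) (hlambda : lambda != 0).
Local Notation omega := (omega alpha gamma g hbeta hlambda).

HB.instance Definition _ := GRing.Lmodule.copy omega (mpoly 2 C).

Definition omega_act : WH4 C -> omega -> omega :=
  WH4_act (omega_op alpha beta gamma lambda g).

Lemma omega_act_linearl f : linear (omega_act^~ f).
Proof. exact: WH4_act_linearl. Qed.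

Lemma omega_act_linearr u : linear (omega_act u).
Proof. exact/WH4_act_linearr/omega_op_linear. Qed.

Lemma omega_act_bracket u w f :
  omega_act (bracket u w) f
    = omega_act u (omega_act w f) - omega_act w (omega_act u f).
Proof.
by apply: WH4_act_bracket; [apply: omega_op_linear | apply: omega_op_bracket].
Qed.

HB.instance Definition _ := Lmodule_isLieModule.Build C (WH4 C) omega
  omega_act_linearl omega_act_linearr omega_act_bracket.

End OmegaModule.

Lemma omega_lact_wb (C : numFieldType) (alpha beta gamma lambda : C) (g : {poly C})
    (hbeta : beta != 0) (hlambda : lambda != 0) x n
    (f : omega alpha gamma g hbeta hlambda) :
  lact (wb C x n) f = omega_op alpha beta gamma lambda g x n f.
Proof. exact: WH4_act_wb. Qed.

Arguments omega {C} alpha beta gamma lambda g hbeta hlambda.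

Definition omega_tensor (C : numFieldType) (m : nat)
    (alpha beta gamma lambda : 'I_m -> C) (g : 'I_m -> {poly C})
    (hbeta : forall k, beta k != 0) (hlambda : forall k, lambda k != 0) :
    lieModType (WH4 C) :=
  tensor_module (fun k : 'I_m =>
    omega (alpha k) (beta k) (gamma k) (lambda k) (g k) (hbeta k) (hlambda k)
      : lieModType (WH4 C)).

Arguments omega_tensor {C m} alpha beta gamma lambda g hbeta hlambda.

(* Main.v *)
(* The action of x_n on a vector w is a sum over k of lambda_k^n times a polynomial *)
(* in n, by Taylor expansion of f(s_k - n). If the lambda_k are distinct, every        *)
(* coefficient of this exponential polynomial is a linear combination of values, so a *)
(* submodule is stable under s_k, t_k and the derivatives in s_k and t_k; it is then a *)
(* submodule for the Weyl algebra in 2m variables, over which the polynomials are      *)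
(* simple. If lambda_j = lambda_k with j <> k, the vectors on which the shifts of s_j  *)
(* and s_k agree, i.e. the polynomials involving s_j and s_k only through s_j + s_k,   *)
(* form a proper nonzero submodule.                                                    *)

From HB Require Import structures.
Require Import Defs.
From mathcomp Require Import all_boot all_order all_algebra.
From mathcomp Require Import boolp mpoly.
From mathcomp Require Import reals complex.
Set Implicit Arguments. Unset Strict Implicit. Unset Printing Implicit Defensive.
Import Order.TTheory GRing.Theory Num.Theory.
Local Open Scope ring_scope.

(** * Interpolation of exponential polynomials *)

(** On the k-th factor, [x_n] sends f to lambda_k^n times a polynomial in n whose coefficients are
    linear operators applied to f. When the lambda_k are nonzero and distinct, the functions n ->
    lambda_k^n n^j are linearly independent, so finite weights c_n isolate one power n^j in one
    factor ([exp_poly_dual]). A submodule is therefore stable under each coefficient operator acting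
    in a single slot ([slot_stable_coef]). Low coefficients of L_n, a_n, c_n and b_n give s_k, t_k
    and the derivatives in s_k and t_k.

    A nonzero subspace stable under these operators is everything ([weyl_stable_trivial]). In
    characteristic zero, differentiation brings a nonzero vector down to a nonzero multiple of 1 (x)
    ... (x) 1, and multiplications then produce all pure tensors.

    Conversely, shifting s_i commutes with the action up to a term that depends on slot i only
    through lambda_i and the shifted vector ([slot_shift_act]). If lambda_j = lambda_k, the vectors
    on which the shifts of s_j and s_k agree thus form a submodule. It contains 1 (x) ... (x) 1 but
    not s_j. *)

Section ExponentialPolynomials.
Variable C : numFieldType.

(** The Euler operator: it multiplies X^n by n. Hence the value of theta^j p at lambda is the sum of
    p_n n^j lambda^n, and finding weights dual to exponential polynomials becomes Hermite
    interpolation at the points lambda_k. *)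
Definition theta (p : {poly C}) : {poly C} := 'X * p^`().

Lemma thetaB : {morph theta : p q / p - q}.
Proof. by move=> p q; rewrite /theta derivB mulrBr. Qed.

Lemma thetaZ a : {morph theta : p / a *: p}.
Proof. by move=> p; rewrite /theta derivZ scalerAr. Qed.

Lemma iter_thetaB j : {morph iter j theta : p q / p - q}.
Proof. by elim: j => [|j IH] p q //=; rewrite IH thetaB. Qed.

Lemma iter_thetaZ j a : {morph iter j theta : p / a *: p}.
Proof. by elim: j => [|j IH] p //=; rewrite IH thetaZ. Qed.

Lemma iter_theta_sum j (I : Type) (r : seq I) (P : pred I) (p : I -> {poly C}) :
  iter j theta (\sum_(i <- r | P i) p i) = \sum_(i <- r | P i) iter j theta (p i).
Proof.
have t0 : iter j theta 0 = 0 by rewrite -[in LHS](subrr 0) iter_thetaB subrr.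
apply: (big_morph _ _ t0) => p1 p2.
by rewrite -[p2 in LHS]opprK iter_thetaB -[- p2]sub0r iter_thetaB t0 sub0r opprK.
Qed.

Lemma horner_iter_theta j (p : {poly C}) x :
  (iter j theta p).[x] = \sum_(n < size p) p`_n * (x ^+ n * n%:R ^+ j).
Proof.
have coefE i : (iter j theta p)`_i = p`_i * i%:R ^+ j.
  elim: j => [|j IH] /=; first by rewrite expr0 mulr1.
  rewrite /theta coefXM coef_deriv; case: i IH => [|i] IH /=; first by rewrite exprS mul0r mulr0.
  by rewrite IH exprSr mulrA mulr_natr.
have le : (size (iter j theta p) <= size p)%N.
  by apply/leq_sizeP => i le_pi; rewrite coefE nth_default ?mul0r.
rewrite (horner_coef_wide _ le); apply: eq_bigr => n _.
by rewrite coefE -mulrA [_ ^+ j * _]mulrC.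
Qed.

(** Each application of [theta] lowers the order of vanishing at a by one. The new cofactor takes
    the value a (l+1) q(a) at a, which is nonzero by characteristic zero and a <> 0. *)
Lemma iter_theta_root (a : C) j i (p : {poly C}) : (j <= i)%N ->
  exists2 q, iter j theta (('X - a%:P) ^+ i * p) = ('X - a%:P) ^+ (i - j) * q
    & (a != 0 -> p.[a] != 0 -> q.[a] != 0).
Proof.
elim: j => [_|j IH lt_ji]; first by exists p => //; rewrite subn0.
have [q qE q_neq0] := IH (ltnW lt_ji).
pose l := (i - j.+1)%N; have lE : (i - j)%N = l.+1 by rewrite /l subnSK.
exists ('X * (q *+ l.+1 + ('X - a%:P) * q^`())).
  rewrite /= qE lE -/l /theta derivM deriv_exp derivXsubC mul1r /= exprSr.
  by rewrite mulrnAl -mulrnAr -mulrA -mulrDr mulrCA.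
move=> a0 pa; rewrite !hornerE hornerMn subrr mul0r addr0.
by rewrite mulf_neq0 // mulrn_eq0 /= q_neq0.
Qed.

Lemma iter_theta_horner0 (a : C) j i (p : {poly C}) : (j < i)%N ->
  (iter j theta (('X - a%:P) ^+ i * p)).[a] = 0.
Proof.
move=> lt_ji; have [q -> _] := iter_theta_root a p (ltnW lt_ji).
by rewrite hornerM horner_exp !hornerE subrr expr0n subn_eq0 leqNgt lt_ji mul0r.
Qed.

(* Triangular in j: theta^j kills (X - a)^i M at a for j < i and is nonzero for j = i. *)
Lemma theta_dual (a : C) (M : {poly C}) N j0 : a != 0 -> M.[a] != 0 -> (j0 < N)%N ->
  exists r, forall j, (j < N)%N -> (iter j theta (M * r)).[a] = (j == j0)%:R.
Proof.
(* Descending induction on j0: the dual polynomials for all i > j0 are already available. *)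
move=> a0 Ma; have [d] := ubnP (N - j0); elim: d j0 => // d IH j0 led lt_j0.
have /choice [r rE] : forall i : 'I_N, exists r, (j0 < i)%N ->
    forall j, (j < N)%N -> (iter j theta (M * r)).[a] = (j == i)%:R.
  move=> i; have [lt_i|] := boolP (j0 < i)%N; last by exists 0.
  have [||r rE] := IH i; [|done|by exists r].
  by rewrite (leq_trans _ (ltnSE led)) // ltn_sub2l.
have [q qE q_neq0] := iter_theta_root a M (leqnn j0).
move: qE (q_neq0 a0 Ma); rewrite subnn expr0 mul1r => qE {}q_neq0.
(* M p has the right values for j <= j0. Its unwanted values for j > j0 are then cancelled with the
   polynomials r_i, which do not disturb the values at j <= j0. *)
pose p := q.[a]^-1 *: ('X - a%:P) ^+ j0.
exists (p - \sum_(i < N | (j0 < i)%N) (iter i theta (M * p)).[a] *: r i) => j lt_j.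
rewrite mulrBr iter_thetaB hornerD hornerN mulr_sumr iter_theta_sum horner_sum.
rewrite (eq_bigr (fun i : 'I_N =>
    (iter i theta (M * p)).[a] * (j == i)%:R)); last first.
  by move=> i lt_i; rewrite -scalerAr iter_thetaZ hornerZ rE.
have MpE : M * p = q.[a]^-1 *: (('X - a%:P) ^+ j0 * M) by rewrite -scalerAr mulrC.
case: (ltngtP j j0) => [lt|gt|->].
- rewrite big1 ?subr0 => [|i lt_i]; last first.
    by rewrite (ltn_eqF (ltn_trans lt lt_i)) mulr0.
  by rewrite MpE iter_thetaZ hornerZ iter_theta_horner0 ?mulr0.
- rewrite (bigD1 (Ordinal lt_j)) //= eqxx mulr1 big1 ?addr0 ?subrr //.
  move=> i /andP[_ ne]; rewrite (_ : (j == i) = false) ?mulr0 //.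
  by apply/negbTE; apply: contra ne => /eqP e; apply/eqP/val_inj.
- rewrite big1 ?subr0 => [|i lt_i]; last by rewrite (ltn_eqF lt_i) mulr0.
  by rewrite MpE iter_thetaZ hornerZ qE mulVf.
Qed.

Lemma exp_poly_dual (m : nat) (lambda : 'I_m -> C) (N : nat) (k0 : 'I_m) (j0 : nat) :
  (forall j k, j != k -> lambda j != lambda k) -> (forall k, lambda k != 0) ->
  (j0 < N)%N ->
  exists c : {poly C}, forall k j, (j < N)%N ->
    \sum_(n < size c) c`_n * (lambda k ^+ n * n%:R ^+ j) = ((k == k0) && (j == j0))%:R.
Proof.
move=> lam_inj lam0 lt_j0.
(* The factor M vanishes to order N at every other lambda_k, so theta^j of any multiple of M
   vanishes there for j < N. Only the values at lambda_k0 remain to be prescribed. *)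
pose M := \prod_(k | k != k0) ('X - (lambda k)%:P) ^+ N.
have M0 : M.[lambda k0] != 0.
  rewrite horner_prod; apply/prodf_neq0 => k ne.
  by rewrite horner_exp !hornerE expf_neq0 // subr_eq0 lam_inj // eq_sym.
have [r rE] := theta_dual (lam0 k0) M0 lt_j0.
exists (M * r) => k j lt_j; rewrite -horner_iter_theta.
have [->|ne] := eqVneq k k0; first exact: rE.
by rewrite /M (bigD1 k) //= -mulrA iter_theta_horner0.
Qed.

End ExponentialPolynomials.

(** * Operators on one tensor factor *)

Section LinearCombinations.
Variables (F : fieldType) (U V : lmodType F).

Lemma linear_comb (f h : U -> V) c : linear f -> linear h ->
  linear (fun x => c *: f x + h x).
Proof.
by move=> fl hl a x y; rewrite fl hl !scalerDr !scalerA [c * a]mulrC addrACA.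
Qed.

Lemma linear_scale (f : U -> V) c : linear f -> linear (fun x => c *: f x).
Proof. by move=> fl a x y; rewrite fl scalerDr !scalerA mulrC. Qed.

Lemma linear_bigsum (I : Type) (r : seq I) (f : I -> U -> V) :
  (forall i, linear (f i)) -> linear (fun x => \sum_(i <- r) f i x).
Proof.
move=> fl a x y; rewrite scaler_sumr -big_split /=.
by apply: eq_bigr => i _; apply: fl.
Qed.

End LinearCombinations.

Section Slot.
Variables (F : fieldType) (m : nat) (V : lmodType F).
Local Notation T := (tensor (fun _ : 'I_m => V)).
Local Notation fam := {dffun forall k : 'I_m, V}.
Local Notation upd v k x := (@upd F m (fun _ => V) v k x).
Implicit Types (v : fam) (k : 'I_m).

Lemma tensor_ext (U : lmodType F) (f g : T -> U) : linear f -> linear g ->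
  (forall v, f (pure v) = g (pure v)) -> forall t, f t = g t.
Proof.
move=> fl gl fg t; elim/tensor_ind: t => [|a s t IHs IHt|//].
  have := fl (-1) 0 0; have := gl (-1) 0 0.
  by rewrite addr0 scaler0 !scaleN1r !addNr => -> ->.
by rewrite fl gl IHs IHt.
Qed.

Lemma pure_lin (v : fam) k a (x y : V) :
  pure (upd v k (a *: x + y)) = a *: pure (upd v k x) + pure (upd v k y).
Proof. exact: (@pure_multilinear F m (fun _ => V)). Qed.

(** The operator 1 (x) ... (x) A (x) ... (x) 1, meaningful for linear A. *)
Definition slot (k : 'I_m) (A : V -> V) : T -> T :=
  tensor_lift (fun v : fam => pure (upd v k (A (v k)))).

Lemma slot_multilinear k (A : V -> V) : linear A ->
  @multilinear F m (fun _ => V) T (fun v : fam => pure (upd v k (A (v k)))).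
Proof.
move=> Al v j a x y; have [e|kj] := eqVneq j k.
  by subst j; rewrite !updE !upd_upd Al pure_lin.
by rewrite !updNE // !(updC _ _ _ kj) pure_lin.
Qed.

Lemma slot_pure k (A : V -> V) : linear A ->
  forall v, slot k A (pure v) = pure (upd v k (A (v k))).
Proof. by move=> Al; apply/tensor_lift_pure/slot_multilinear. Qed.

Lemma slot_linear k (A : V -> V) : linear A -> linear (slot k A).
Proof. by move=> Al; apply/tensor_lift_linear/slot_multilinear. Qed.

Lemma slot0r k (A : V -> V) : linear A -> slot k A 0 = 0.
Proof.
move=> Al; have := slot_linear k Al (-1) 0 0.
by rewrite scaler0 addr0 scaleN1r addNr.
Qed.

Lemma slot_sum k (A : V -> V) (I : Type) (r : seq I) (F' : I -> T) : linear A ->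
  slot k A (\sum_(i <- r) F' i) = \sum_(i <- r) slot k A (F' i).
Proof.
move=> Al; apply: (big_morph (slot k A)) => [s t|]; last exact: slot0r.
by rewrite -[s in LHS]scale1r slot_linear // scale1r.
Qed.

Lemma slot_comp k (A B : V -> V) : linear A -> linear B ->
  forall t, slot k A (slot k B t) = slot k (fun x => A (B x)) t.
Proof.
move=> Al Bl; have ABl : linear (fun x => A (B x)) by move=> a x y; rewrite Bl Al.
apply: tensor_ext => [a s t|a s t|v]; rewrite ?slot_linear ?slot_pure //.
by rewrite updE upd_upd.
Qed.

Lemma slot_comm j k (A B : V -> V) : j != k ->
  linear A -> linear B -> forall t, slot j A (slot k B t) = slot k B (slot j A t).
Proof.
move=> jk Al Bl; apply: tensor_ext => [a s t|a s t|v]; rewrite ?slot_linear ?slot_pure //.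
by rewrite !updNE // 1?eq_sym // updC // eq_sym.
Qed.

Lemma slot_comb k (A B : V -> V) c : linear A -> linear B ->
  forall t, slot k (fun x => c *: A x + B x) t = c *: slot k A t + slot k B t.
Proof.
move=> Al Bl; have ABl := linear_comb c Al Bl.
apply: tensor_ext => [|a s t|v]; first exact: slot_linear.
  by rewrite (slot_linear k Al) (slot_linear k Bl) !scalerDr !scalerA [c * a]mulrC addrACA.
by rewrite !slot_pure // pure_lin.
Qed.

Lemma slot_id k t : slot k (fun x : V => x) t = t.
Proof.
move: t; apply: tensor_ext => [|//|v]; first exact: slot_linear.
by rewrite slot_pure // upd_id.
Qed.

Lemma pureZ (v : fam) k a (x : V) : pure (upd v k (a *: x)) = a *: pure (upd v k x).
Proof.
have pure0 : pure (upd v k (0 : V)) = 0.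
  by have := pure_lin v k (-1) 0 0; rewrite scaler0 addr0 scaleN1r addNr.
by have := pure_lin v k a x 0; rewrite !addr0 pure0 addr0.
Qed.

Lemma pure_sum (I : Type) (r : seq I) (v : fam) k (x : I -> V) :
  pure (upd v k (\sum_(i <- r) x i)) = \sum_(i <- r) pure (upd v k (x i)).
Proof.
apply: (big_morph (fun y : V => pure (upd v k y))) => [y z|].
  by rewrite -[y in LHS]scale1r pure_lin scale1r.
by have := pureZ v k 0 0; rewrite !scale0r.
Qed.

(** Records a bound on the components of some presentation of a tensor as a sum of pure tensors, so
    that degrees can be controlled without choosing a basis of the tensor product. *)
Inductive tensor_span (S : fam -> Prop) : T -> Prop :=
| tensor_span_pure v : S v -> tensor_span S (pure v)
| tensor_span0 : tensor_span S 0
| tensor_span_comb a s t :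
    tensor_span S s -> tensor_span S t -> tensor_span S (a *: s + t).

Lemma tensor_span_slot (S S' : fam -> Prop) k (A : V -> V) : linear A ->
  (forall v, S v -> tensor_span S' (pure (upd v k (A (v k))))) ->
  forall t, tensor_span S t -> tensor_span S' (slot k A t).
Proof.
move=> Al SS' t; elim=> [v Sv||a s u _ IHs _ IHu].
- by rewrite slot_pure //; apply: SS'.
- by rewrite slot0r //; apply: tensor_span0.
- by rewrite slot_linear //; apply: tensor_span_comb.
Qed.

Lemma tensor_span_sub (S S' : fam -> Prop) : (forall v, S v -> S' v) ->
  forall t, tensor_span S t -> tensor_span S' t.
Proof.
move=> SS' t; elim=> [v /SS'||a s u _ IHs _ IHu]; first exact: tensor_span_pure.
  exact: tensor_span0.
exact: tensor_span_comb.
Qed.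

Lemma tensor_span_full t : tensor_span (fun _ => True) t.
Proof.
elim/tensor_ind: t => [|a s t Hs Ht|v]; first exact: tensor_span0.
  exact: tensor_span_comb.
exact: tensor_span_pure.
Qed.

(** Only finitely many pure tensors occur, so an increasing exhaustive filtration gives one index
    valid for all of them. *)
Lemma tensor_span_directed (S0 : fam -> Prop) (S : nat -> fam -> Prop) :
  (forall i j v, (i <= j)%N -> S i v -> S j v) -> (forall v, exists i, S i v) ->
  forall t, tensor_span S0 t -> exists i, tensor_span (fun v => S0 v /\ S i v) t.
Proof.
move=> Sle Sex t; elim=> [v S0v||a s u _ [i Hi] _ [j Hj]].
- by have [i Si] := Sex v; exists i; apply: tensor_span_pure.
- by exists 0%N; apply: tensor_span0.
- exists (maxn i j); apply: tensor_span_comb.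
    by apply: tensor_span_sub Hi => v [S0v Sv]; split=> //; apply: Sle (leq_maxl _ _) _.
  by apply: tensor_span_sub Hj => v [S0v Sv]; split=> //; apply: Sle (leq_maxr _ _) _.
Qed.

Lemma tensor_span_ext (S : fam -> Prop) (U : lmodType F) (f g : T -> U) :
  linear f -> linear g -> (forall v, S v -> f (pure v) = g (pure v)) ->
  forall t, tensor_span S t -> f t = g t.
Proof.
move=> fl gl fg t; elim=> [v /fg //||a s u _ IHs _ IHu]; last by rewrite fl gl IHs IHu.
have := fl (-1) 0 0; have := gl (-1) 0 0.
by rewrite addr0 scaler0 !scaleN1r !addNr => -> ->.
Qed.

End Slot.

(** * Polynomials in s and t *)

Lemma scaler_natX (C : numFieldType) (V : algType C) a (f : V) n j :
  a *: (f * n%:R ^+ j) = (a * n%:R ^+ j) *: f.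
Proof. by rewrite -natrX mulr_natr -scaler_nat scalerA natrX. Qed.

(* The Taylor expansion of f(s - x, t) in the polynomial variable x. *)
HB.lock Definition taylor_s (C : numFieldType) : {mpoly C[2]} -> {poly {mpoly C[2]}} :=
  mmap (polyC \o @mpolyC 2 C)
    (fun i => if i == ord0 then (var_s C)%:P - 'X else (var_t C)%:P).

Section TwoVariables.
Variable C : numFieldType.
Local Notation P := {mpoly C[2]}.
Local Notation taylor_s := (@taylor_s C).

Definition partial_s (f : P) : P := f^`M(ord0).

Lemma taylor_sC c : taylor_s c%:MP = c%:MP%:P.
Proof. by rewrite taylor_s.unlock mmapC. Qed.

Lemma taylor_s_s : taylor_s (var_s C) = (var_s C)%:P - 'X.
Proof. by rewrite taylor_s.unlock mmapX mmap1U. Qed.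

Lemma taylor_s_t : taylor_s (var_t C) = (var_t C)%:P.
Proof. by rewrite taylor_s.unlock mmapX mmap1U. Qed.

Lemma taylor_sD : {morph taylor_s : p q / p + q}.
Proof. by rewrite taylor_s.unlock; apply: mmapD. Qed.

Lemma taylor_sM : {morph taylor_s : p q / p * q}.
Proof. by rewrite taylor_s.unlock; apply: (mmap_is_multiplicative _ _).1. Qed.

Lemma taylor_s_linear a f h : taylor_s (a *: f + h) = a%:MP%:P * taylor_s f + taylor_s h.
Proof. by rewrite taylor_sD -mul_mpolyC taylor_sM taylor_sC. Qed.

Lemma horner_taylor_s f (n : nat) : (taylor_s f).[n%:R] = shift n f.
Proof.
elim/mpoly2_ind: f => [c|||p q IHp IHq|p q IHp IHq].
- by rewrite taylor_sC hornerC shiftC.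
- by rewrite taylor_s_s shift_s !hornerE rmorph_nat.
- by rewrite taylor_s_t hornerC shift_t.
- by rewrite taylor_sD hornerD IHp IHq shiftD.
- by rewrite taylor_sM hornerM IHp IHq shiftM.
Qed.

Lemma coef0_taylor_s f : (taylor_s f)`_0 = f.
Proof.
rewrite -horner_coef0 (horner_taylor_s f 0).
elim/mpoly2_ind: f => [c|||p q IHp IHq|p q IHp IHq].
- by rewrite shiftC.
- by rewrite shift_s subr0.
- by rewrite shift_t.
- by rewrite shiftD IHp IHq.
- by rewrite shiftM IHp IHq.
Qed.

Lemma partial_s_linear : linear partial_s.
Proof. by move=> a p q; rewrite /partial_s linearP. Qed.

Lemma partial_t_linear : linear (@partial_t C).
Proof. by move=> a p q; rewrite /partial_t linearP. Qed.

Lemma shift_linear n : linear (@shift C n).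
Proof. by move=> a p q; rewrite -!mul_mpolyC shiftD shiftM shiftC. Qed.

(** Since the constant term is f itself, the linear coefficient obeys the Leibniz rule. It is thus
    determined by its values on s and t. *)
Lemma coef1_taylor_s f : (taylor_s f)`_1 = - partial_s f.
Proof.
elim/mpoly2_ind: f => [c|||p q IHp IHq|p q IHp IHq].
- by rewrite taylor_sC coefC /= /partial_s mderivC oppr0.
- rewrite taylor_s_s coefB coefC coefX /= sub0r /partial_s /var_s mderivX mnm1E eqxx.
  rewrite scale1r -mpolyX0; congr (- mpolyX _ _).
  by apply/mnmP => i; rewrite mnmBE mnm0E subnn.
- by rewrite taylor_s_t coefC /= /partial_s /var_t mderivX mnm1E /= scale0r oppr0.
- by rewrite taylor_sD coefD IHp IHq /partial_s raddfD opprD.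
- rewrite taylor_sM coefM big_ord_recl big_ord1 /= !coef0_taylor_s IHp IHq.
  by rewrite /partial_s mderivM mulrN mulNr opprD addrC.
Qed.

Lemma linear_mull (p : P) : linear (fun f => p * f).
Proof. by move=> a f h; rewrite mulrDr -!scalerAr. Qed.

Lemma linear_coef_taylor_s (q : {poly P}) (B : P -> P) i : linear B ->
  linear (fun f => (q * taylor_s (B f))`_i).
Proof.
move=> Bl a f h; rewrite Bl taylor_s_linear mulrDr mulrCA coefD coefCM.
by rewrite mul_mpolyC.
Qed.

Definition eval0 (f : P) : P := (f@_0)%:MP.

Definition div_deg (f : P) : P :=
  \sum_(m <- msupp f) (f@_m / (mdeg m)%:R) *: 'X_[m].

Lemma mcoeff_div_deg f m : (div_deg f)@_m = f@_m / (mdeg m)%:R.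
Proof.
rewrite /div_deg linear_sum /=.
have [mf|mf] := boolP (m \in msupp f); last first.
  rewrite (memN_msupp_eq0 mf) mul0r big_seq big1 // => k kf.
  by rewrite mcoeffZ mcoeffX; case: eqP => [e|_]; rewrite ?mulr0 // -e kf in mf *.
rewrite (bigD1_seq m) ?msupp_uniq //= mcoeffZ mcoeffX eqxx mulr1 big1 ?addr0 // => k ne.
by rewrite mcoeffZ mcoeffX (negbTE ne) mulr0.
Qed.

Lemma div_deg_linear : linear div_deg.
Proof.
move=> a p q; apply/mpolyP => m; rewrite mcoeffD mcoeffZ !mcoeff_div_deg.
by rewrite mcoeffD mcoeffZ mulrDl mulrA.
Qed.

Lemma eval0_linear : linear eval0.
Proof.
by move=> a p q; rewrite /eval0 mcoeffD mcoeffZ mpolyCD mpolyCM mul_mpolyC.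
Qed.

Lemma mcoeff_euler i (f : P) m : ('X_i * f^`M(i))@_m = f@_m *+ m i.
Proof.
elim/mpolyind: f => [|c k p _ _ IH]; first by rewrite mderiv0 mulr0 mcoeff0 mul0rn.
rewrite mderivD mulrDr !mcoeffD IH mulrnDl mderivZ mderivX scalerA -scalerAr.
rewrite -mpolyXD !mcoeffZ !mcoeffX -mulrA -[in RHS]mulrnAr; congr (c * _ + _).
(* Subtraction of exponents is truncated, so [k - U_(i)] loses nothing only when [k i] is positive.
   Otherwise the derivative has coefficient 0. *)
have [k0|k0] := eqVneq (k i) 0%N.
  by rewrite k0 mul0r; have [<-|_] := eqVneq k m; rewrite ?k0 ?mul0rn.
have -> : (U_(i) + (k - U_(i)) = k)%MM.
  apply/mnmP => j; rewrite mnmDE mnmBE mnm1E; case: eqP => [<-|_]; last by rewrite subn0.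
  by rewrite addnC subnK ?lt0n.
by have [<-|_] := eqVneq k m; rewrite ?mulr1 ?mulr0 ?mul0rn.
Qed.

(* Euler's identity, the homogeneous components being divided by their degree; *)
(* the junk value 1 / 0 = 0 discards the constant term.                        *)
Lemma euler_decomposition f :
  f = div_deg (var_s C * partial_s f) + div_deg (var_t C * partial_t f) + eval0 f.
Proof.
apply/mpolyP => m; rewrite !mcoeffD !mcoeff_div_deg !mcoeff_euler -mulrDl -mulrnDr.
have -> : (m ord0 + m ord_max = mdeg m)%N.
  rewrite mdegE big_ord_recl big_ord1; congr (_ + m _)%N; exact/val_inj.
rewrite mcoeffC; have [->|m0] := eqVneq m 0%MM.
  by rewrite mdeg0 mulr0n mul0r add0r mulr1.
by rewrite mulr0 addr0 -[_@_m *+ _]mulr_natr mulfK // pnatr_eq0 mdeg_eq0.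
Qed.

Definition deg_lt (N : nat) (f : P) := forall m, (N <= mdeg m)%N -> f@_m = 0.

Lemma deg_lt_le M N f : (M <= N)%N -> deg_lt M f -> deg_lt N f.
Proof. by move=> le_MN df m le_Nm; apply/df/(leq_trans le_MN). Qed.

Lemma deg_lt_msize f : deg_lt (msize f) f.
Proof.
move=> m le_fm; apply: memN_msupp_eq0; apply/negP => /msize_mdeg_lt.
by rewrite ltnNge le_fm.
Qed.

Lemma deg_lt0 f : deg_lt 0 f -> f = 0.
Proof. by move=> df; apply/mpolyP => m; rewrite df // mcoeff0. Qed.

Lemma deg_lt_mderiv i N f : deg_lt N.+1 f -> deg_lt N f^`M(i).
Proof.
by move=> df m le_Nm; rewrite mcoeff_deriv df ?mul0rn // mdegD mdeg1 addn1.
Qed.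

End TwoVariables.

(** * Submodules of the tensor product *)

Section PolynomialTensors.
Variables (C : numFieldType) (m : nat).
Local Notation P := {mpoly C[2]}.
Local Notation T := (tensor (fun _ : 'I_m => P : lmodType C)).
Local Notation slot := (@slot C m P).
Local Notation fam := {dffun forall k : 'I_m, P}.
Local Notation upd v k x := (@upd C m (fun _ => P) v k x).
Local Notation span := (@tensor_span C m P).

Definition subspace (W : T -> Prop) :=
  W 0 /\ forall a s t, W s -> W t -> W (a *: s + t).

Definition slot_stable (W : T -> Prop) k (A : P -> P) :=
  forall w, W w -> W (slot k A w).

Definition one_fam : fam := [ffun _ => 1].

(** Multiplying the components together is multilinear, and the induced linear map sends this tensor
    to 1. *)
Lemma pure_one_neq0 : (pure one_fam : T) != 0.
Proof.
pose f (v : fam) : P := \prod_k v k.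
have f_ml : @multilinear C m (fun _ => P) P f.
  move=> v k a x y.
  have E z : f (upd v k z) = z * \prod_(i < m | i != k) v i.
    rewrite /f (bigD1 k) //= updE; congr (_ * _).
    by apply: eq_bigr => i ne; rewrite updNE // eq_sym.
  by rewrite !E mulrDl scalerAl.
have l0 : tensor_lift f 0 = 0.
  have := tensor_lift_linear f_ml (-1) 0 0.
  by rewrite scaler0 addr0 scaleN1r addNr.
apply/eqP => e; have := tensor_lift_pure f_ml one_fam.
rewrite e l0 /f big1 => [/esym/eqP|k _]; first by rewrite oner_eq0.
by rewrite ffunE.
Qed.

(** * Simplicity of the polynomials under multiplications and derivatives *)

Section WeylSimplicity.
Variable W : T -> Prop.
Hypothesis W_sub : subspace W.
Hypothesis W_mul : forall k p, slot_stable W k (fun f => p * f).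
Hypothesis W_ds : forall k, slot_stable W k (@partial_s C).
Hypothesis W_dt : forall k, slot_stable W k (@partial_t C).

Lemma generated_by_one : W (pure one_fam) -> forall t, W t.
Proof.
have [W0 Wl] := W_sub.
move=> W1 t; elim/tensor_ind: t => [//|a s t|v]; first exact: Wl.
have : forall r : seq 'I_m, W (pure ([ffun k => if k \in r then v k else 1] : fam)).
  elim=> [|k r IH].
    by rewrite (_ : [ffun _ => _] = one_fam) //; apply/ffunP => k; rewrite !ffunE.
  have [kr|kr] := boolP (k \in r).
    rewrite (_ : [ffun _ => _] = [ffun j => if j \in r then v j else 1]) //.
    by apply/ffunP => j; rewrite !ffunE inE; case: eqP => [->|]; rewrite ?kr.
  have := @W_mul k (v k) _ IH; rewrite slot_pure; last exact: linear_mull.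
  congr (W (pure _)); apply/ffunP => j; have [<-|ne] := eqVneq k j.
    by rewrite updE !ffunE (negbTE kr) inE eqxx mulr1.
  by rewrite updNE // !ffunE inE eq_sym (negbTE ne).
move=> /(_ (enum 'I_m)); congr (W (pure _)).
by apply/ffunP => k; rewrite !ffunE mem_enum.
Qed.

(** Euler's identity applied inside slot k: a tensor killed by both derivatives there is constant in
    that slot. *)
Lemma slot_euler k (w : T) : slot k (@partial_s C) w = 0 -> slot k (@partial_t C) w = 0 ->
  w = slot k (@eval0 C) w.
Proof.
pose A f : P := div_deg (var_s C * f); pose B f : P := div_deg (var_t C * f).
have Al : linear A by move=> a f h; rewrite /A linear_mull div_deg_linear.
have Bl : linear B by move=> a f h; rewrite /B linear_mull div_deg_linear.
have dsl := @partial_s_linear C; have dtl := @partial_t_linear C.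
have ADl : linear (fun f => A (partial_s f)) by move=> a f h; rewrite dsl Al.
have BDl : linear (fun f => B (partial_t f)) by move=> a f h; rewrite dtl Bl.
have e0l := @eval0_linear C.
move=> ds0 dt0; transitivity (slot k (fun f => 1 *: A (partial_s f)
    + (1 *: B (partial_t f) + eval0 f)) w).
  rewrite -[LHS](slot_id k); congr (slot _ _ w); apply/funext => f.
  by rewrite !scale1r addrA; apply: euler_decomposition.
rewrite (slot_comb k 1 ADl (linear_comb 1 BDl e0l)) (slot_comb k 1 BDl e0l).
rewrite -(slot_comp k Al dsl) -(slot_comp k Bl dtl) ds0 dt0 (slot0r _ Al) (slot0r _ Bl).
by rewrite scaler0 !add0r.
Qed.

Definition ones_on (r : seq 'I_m) (v : fam) := forall k, k \in r -> v k = 1.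

Lemma ones_on_upd r (v : fam) k x : k \notin r -> ones_on r v -> ones_on r (upd v k x).
Proof.
move=> kr v1 j jr; rewrite updNE ?v1 //.
by apply: contraNneq kr => ->.
Qed.

(** Induction on a degree bound for slot k. A nonzero derivative in s_k or t_k stays in W and lowers
    the bound. If both vanish, slot k is constant by [slot_euler] and the constant moves out as a
    scalar. Slots already equal to 1 are untouched. *)
Lemma reduce_slot r k (w : T) : k \notin r -> W w -> w != 0 -> span (ones_on r) w ->
  exists w', [/\ W w', w' != 0 & span (ones_on (k :: r)) w'].
Proof.
move=> kr Ww w0 Sw.
pose S N (v : fam) := deg_lt N (v k).
have [||N] := @tensor_span_directed C m P _ S _ _ w Sw.
- by move=> i j v le_ij; apply: deg_lt_le.
- by move=> v; exists (msize (v k)); apply: deg_lt_msize.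
elim: N w {Sw} Ww w0 => [|N IH] w Ww w0 Sw.
  case/eqP: w0; move: w Sw {Ww}.
  apply: (tensor_span_ext (g := fun _ => 0)) => [//|a x y|v [_ /deg_lt0 v0]].
    by rewrite scaler0 addr0.
  by rewrite -[v](upd_id v k) v0 -[0](scale0r 0) pureZ scale0r.
have Sd (D : P -> P) : linear D -> (forall f, deg_lt N.+1 f -> deg_lt N (D f)) ->
    span (fun v => ones_on r v /\ S N v) (slot k D w).
  move=> Dl degD; apply: (tensor_span_slot Dl) Sw => v [v1 dv].
  apply: tensor_span_pure; split; first exact: ones_on_upd.
  by rewrite /S updE; apply: degD.
have [ds0|ds0] := eqVneq (slot k (@partial_s C) w) 0; last first.
  apply: (IH (slot k (@partial_s C) w)) => //; first exact: W_ds.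
  by apply: Sd; [apply: partial_s_linear | move=> f; apply: deg_lt_mderiv].
have [dt0|dt0] := eqVneq (slot k (@partial_t C) w) 0; last first.
  apply: (IH (slot k (@partial_t C) w)) => //; first exact: W_dt.
  by apply: Sd; [apply: partial_t_linear | move=> f; apply: deg_lt_mderiv].
exists w; split=> //; rewrite (slot_euler ds0 dt0).
apply: (tensor_span_slot (@eval0_linear C)) Sw => v [v1 _].
rewrite /eval0 -[_%:MP]mulr1 mul_mpolyC pureZ -[_ *: _]addr0.
apply: tensor_span_comb; last exact: tensor_span0.
apply: tensor_span_pure => j; rewrite inE => /orP[/eqP->|jr]; first by rewrite updE.
exact: (ones_on_upd _ kr v1).
Qed.

Lemma weyl_stable_trivial : (forall w, W w -> w = 0) \/ (forall w, W w).
Proof.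
have [W0 Wl] := W_sub.
have [/existsNP[w /not_implyP[Ww /eqP w0]]|H] := pselect (~ forall w, W w -> w = 0);
  last by left; apply: contrapT.
right; apply: generated_by_one.
have red : forall r, exists w', [/\ W w', w' != 0 & span (ones_on r) w'].
  elim=> [|k r [u [Wu u0 Su]]].
    by exists w; split=> //; apply: tensor_span_sub (tensor_span_full w) => v _ k.
  have [kr|kr] := boolP (k \in r); last exact: reduce_slot Su.
  exists u; split=> //; apply: tensor_span_sub Su => v v1 j; rewrite inE.
  by case: eqP => [-> _|_ /=]; apply: v1.
have [u [Wu u0 Su]] := red (enum 'I_m).
have [c uE] : exists c, u = c *: pure one_fam.
  elim: {Wu u0} Su => [v v1||a x y _ [c ->] _ [d ->]].
  - exists 1; rewrite scale1r; congr pure; apply/ffunP => k.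
    by rewrite ffunE v1 ?mem_enum.
  - by exists 0; rewrite scale0r.
  - by exists (a * c + d); rewrite scalerDl scalerA.
have c0 : c != 0 by apply: contraNneq u0 => c0; rewrite uE c0 scale0r.
rewrite -[pure _]scale1r -(mulVf c0) -scalerA -uE -[_ *: _]addr0.
exact: Wl.
Qed.

End WeylSimplicity.

(** * The action of L, slot by slot *)

Section Action.
Variables (alpha beta gamma lambda : 'I_m -> C) (g : 'I_m -> {poly C}).
Hypotheses (hbeta : forall k, beta k != 0) (hlambda : forall k, lambda k != 0).
Local Notation M := (omega_tensor alpha beta gamma lambda g hbeta hlambda).
Local Notation op k := (omega_op (alpha k) (beta k) (gamma k) (lambda k) (g k)).

Lemma op_linear k x n : linear (op k x n).
Proof. by move=> a p q; apply: omega_op_linear. Qed.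

Lemma omega_lact_slot x n (w : M) :
  lact (wb C x n) w = \sum_k slot k (op k x n) w :> T.
Proof.
pose f (v : fam) : T := \sum_k pure (upd v k (op k x n (v k))).
transitivity (tensor_lift f w : T).
  rewrite [LHS]/lact /=.
  congr (tensor_lift _ _); apply/funext => v; apply: eq_bigr => k _.
  by congr (pure (upd _ _ _)); apply: omega_lact_wb.
have slotl k := slot_linear k (op_linear k x n).
have f_ml : multilinear f.
  move=> v j a y z; rewrite /f scaler_sumr -big_split /=; apply: eq_bigr => k _.
  by apply: slot_multilinear; apply: op_linear.
move: (w : T); apply: tensor_ext => [||v]; first exact: tensor_lift_linear.
  by apply: linear_bigsum => k; apply: slotl.
rewrite tensor_lift_pure //; apply: eq_bigr => k _.
by rewrite slot_pure //; apply: op_linear.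
Qed.

Definition basis_stable (W : T -> Prop) :=
  forall x (n : int) w, W w -> W (\sum_k slot k (op k x n) w).

Lemma submoduleP (W : T -> Prop) :
  submodule (V := M) W <-> subspace W /\ basis_stable W.
Proof.
split=> [[W0 Wl Wact]|[[W0 Wl] Wb]].
  split=> // x n w Ww.
  by have := Wact (wb C x n) w Ww; rewrite omega_lact_slot.
split=> // u w Ww; elim/WH4_ind: u => [|a u1 u2 IH1 IH2|x n].
- have := @lact_linearl C (WH4 C) M w (-1) 0 0.
  by rewrite scaler0 addr0 scaleN1r addNr => ->.
- by rewrite lact_linearl; apply: Wl.
- by rewrite omega_lact_slot; apply: Wb.
Qed.

(** * Recovering multiplications and derivatives when the lambda_k are distinct *)

Section WeylStable.
Variable W : T -> Prop.
Hypotheses (W_sub : subspace W) (W_stable : basis_stable W).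

Let W0 : W 0. Proof. by case: W_sub. Qed.
Let Wlin a s t : W s -> W t -> W (a *: s + t). Proof. by case: W_sub => _; apply. Qed.
Let WZ a s : W s -> W (a *: s).
Proof. by move=> Ws; rewrite -[_ *: _]addr0; apply: Wlin. Qed.
Let Wsum (I : Type) (r : seq I) (F : I -> T) : (forall i, W (F i)) -> W (\sum_(i <- r) F i).
Proof.
move=> WF; elim: r => [|i r IH]; first by rewrite big_nil.
by rewrite big_cons -[F i]scale1r; apply: Wlin.
Qed.

Hypothesis hdiff : forall j k, j != k -> lambda j != lambda k.

(** With the weights c of [exp_poly_dual], the combination of the actions of x_0, x_1, ... on w is
    exactly the j0-th coefficient operator in slot k0. One c suffices because the degrees in n are
    bounded uniformly over a presentation of w. *)
Lemma slot_stable_coef (Th : 'I_m -> P -> {poly P}) x k0 j0 :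
  (forall k i, linear (fun f => (Th k f)`_i)) ->
  (forall k (n : nat) f, op k x n f = lambda k ^+ n *: (Th k f).[n%:R]) ->
  slot_stable W k0 (fun f => (Th k0 f)`_j0).
Proof.
move=> Thl opE w Ww.
pose S N (v : fam) := forall k, (size (Th k (v k)) <= N)%N.
have [||N SN] := @tensor_span_directed C m P _ S _ _ w (tensor_span_full w).
- by move=> i j v le_ij Sv k; apply: leq_trans le_ij.
- move=> v; exists (\max_k size (Th k (v k))) => k.
  exact: (leq_bigmax (F := fun k => size (Th k (v k)))).
(* The bound N may be at most j0, so it is enlarged to make j0 an admissible exponent. *)
have lt_j0 : (j0 < maxn N j0.+1)%N by rewrite leq_max ltnSn orbT.
have [c cE] := exp_poly_dual k0 hdiff hlambda lt_j0.
have opl := op_linear.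
have -> : slot k0 (fun f => (Th k0 f)`_j0) w =
    \sum_(n < size c) c`_n *: \sum_k slot k (op k x (n : nat)) w; last first.
  by apply: Wsum => n; apply/WZ/W_stable.
move: w SN {Ww}; apply: tensor_span_ext => [||v [_ Sv]]; first exact: slot_linear (Thl k0 j0).
  apply: linear_bigsum => n; apply: linear_scale.
  by apply: linear_bigsum => k; apply/slot_linear/opl.
rewrite slot_pure; last exact: Thl.
transitivity (\sum_k pure (upd v k
    (\sum_(n < size c) c`_n *: op k x (n : nat) (v k)))); last first.
  under eq_bigr do rewrite pure_sum.
  rewrite exchange_big /=; apply: eq_bigr => n _; rewrite scaler_sumr.
  by apply: eq_bigr => k _; rewrite pureZ slot_pure //; apply: opl.
have E k : \sum_(n < size c) c`_n *: op k x (n : nat) (v k) =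
    (k == k0)%:R *: (Th k (v k))`_j0.
  transitivity (\sum_(j < maxn N j0.+1) (\sum_(n < size c)
     c`_n * (lambda k ^+ n * n%:R ^+ j)) *: (Th k (v k))`_j); last first.
    rewrite (bigD1 (Ordinal lt_j0)) //= cE // eqxx andbT big1 ?addr0 // => j ne.
    rewrite cE // (_ : (_ == j0) = false) ?andbF ?scale0r //.
    by apply/negbTE; apply: contra ne => /eqP e; apply/eqP/val_inj.
  under [RHS]eq_bigr do rewrite scaler_suml.
  rewrite exchange_big /=; apply: eq_bigr => n _.
  have le_N : (size (Th k (v k)) <= maxn N j0.+1)%N by rewrite leq_max Sv.
  rewrite opE (horner_coef_wide _ le_N) !scaler_sumr; apply: eq_bigr => j _.
  by rewrite scaler_natX scalerA mulrA.
rewrite (eq_bigr _ (fun k _ => congr1 (fun y => pure (upd v k y)) (E k))).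
rewrite (bigD1 k0) //= eqxx scale1r big1 ?addr0 // => k ne.
by rewrite (negbTE ne) pureZ scale0r.
Qed.

Let id_linear : linear (fun f : P => f). Proof. by []. Qed.

Lemma slot_stable_comb k c (A B : P -> P) : linear A -> linear B ->
  slot_stable W k A -> slot_stable W k B -> slot_stable W k (fun f => c *: A f + B f).
Proof.
move=> Al Bl WA WB w Ww; rewrite slot_comb //.
by apply: Wlin; [apply: WA | apply: WB].
Qed.

Lemma slot_stable_comp k (A B : P -> P) : linear A -> linear B ->
  slot_stable W k A -> slot_stable W k B -> slot_stable W k (fun f => A (B f)).
Proof. by move=> Al Bl WA WB w Ww; rewrite -slot_comp //; apply/WA/WB. Qed.

Lemma slot_stable_ext k (A B : P -> P) : A =1 B -> slot_stable W k A -> slot_stable W k B.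
Proof. by move=> /funext ->. Qed.

(** The constant coefficient of (s + n alpha) f(s - n, t) in n is s f. *)
Lemma slot_stable_s k : slot_stable W k (fun f => var_s C * f).
Proof.
pose q k : {poly P} := (var_s C)%:P + (alpha k)%:MP *: 'X.
apply: (@slot_stable_ext _ (fun f => (q k * taylor_s f)`_0)) => [f|].
  by rewrite coefM big_ord1 coef0_taylor_s coefD coefC coefZ coefX mulr0 addr0.
apply: (@slot_stable_coef (fun k f => q k * taylor_s f) gL) => [j i|j n f].
  exact: (linear_coef_taylor_s _ _ id_linear).
rewrite hornerM horner_taylor_s hornerD hornerC hornerZ hornerX /=.
by rewrite mpolyCM rmorph_nat [n%:R * _]mulrC.
Qed.

Lemma slot_stable_t k : slot_stable W k (fun f => var_t C * f).
Proof.
pose q : {poly P} := (var_t C)%:P.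
apply: (@slot_stable_ext _ (fun f => (q * taylor_s f)`_0)) => [f|].
  by rewrite coefCM coef0_taylor_s.
apply: (@slot_stable_coef (fun k f => q * taylor_s f) ga) => [j i|j n f].
  exact: (linear_coef_taylor_s _ _ id_linear).
by rewrite hornerM horner_taylor_s hornerC.
Qed.

Lemma slot_stable_mul k (p : P) : slot_stable W k (fun f => p * f).
Proof.
elim/mpoly2_ind: p => [c|||p q IHp IHq|p q IHp IHq].
- apply: (@slot_stable_ext _ (fun f => c *: f)) => [f|w Ww]; first by rewrite mul_mpolyC.
  have -> : slot k (fun f => c *: f) w = c *: w; last exact: WZ.
  rewrite -[in RHS](slot_id k w); move: w {Ww}.
  apply: tensor_ext => [||v]; first exact/slot_linear/linear_scale.
    exact/linear_scale/slot_linear.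
  by rewrite !slot_pure // ?pureZ //; apply: linear_scale.
- exact: slot_stable_s.
- exact: slot_stable_t.
- apply: (@slot_stable_ext _ (fun f => 1 *: (p * f) + q * f)) => [f|].
    by rewrite scale1r mulrDl.
  by apply: slot_stable_comb => //; apply: linear_mull.
- apply: (@slot_stable_ext _ (fun f => p * (q * f))) => [f|]; first by rewrite mulrA.
  by apply: slot_stable_comp => //; apply: linear_mull.
Qed.

(** By Taylor expansion, the coefficient of n in -beta f(s - n, t), coming from c_n, is beta times
    the derivative of f in s. *)
Lemma slot_stable_partial_s k : slot_stable W k (@partial_s C).
Proof.
pose q k : {poly P} := (- beta k)%:MP%:P.
apply: (@slot_stable_ext _ (fun f => (beta k)^-1%:MP * (q k * taylor_s f)`_1)) => [f|].
  rewrite coefCM coef1_taylor_s mpolyCN mulrNN mulrA -mpolyCM mulVf //.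
  by rewrite mpolyC1 mul1r.
apply: (@slot_stable_comp _ (fun f => (beta k)^-1%:MP * f)
    (fun f => (q k * taylor_s f)`_1)).
- exact: linear_mull.
- exact: (linear_coef_taylor_s _ _ id_linear).
- exact: slot_stable_mul.
apply: (@slot_stable_coef (fun k f => q k * taylor_s f) gc) => [j i|j n f].
  exact: (linear_coef_taylor_s _ _ id_linear).
rewrite hornerM horner_taylor_s hornerC mpolyCN mulNr scalerN mul_mpolyC scalerA.
by [].
Qed.

(** The constant coefficient of b_n is g f plus beta times the derivative of f in t. The term g f is
    removed using stability under multiplication, and beta is inverted. *)
Lemma slot_stable_partial_t k : slot_stable W k (@partial_t C).
Proof.
pose q k : {poly P} := (poly_t (g k))%:P.
pose b k : {poly P} := (beta k)%:MP%:P.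
pose A f : P := (q k * taylor_s f + b k * taylor_s (partial_t f))`_0.
have Al j i : linear (fun f => (q j * taylor_s f + b j * taylor_s (partial_t f))`_i).
  move=> a f h; rewrite !coefD (linear_coef_taylor_s (q j) i id_linear).
  rewrite (linear_coef_taylor_s (b j) i (@partial_t_linear C)).
  by rewrite scalerDr addrACA.
have gl := linear_mull (poly_t (g k)).
apply: (@slot_stable_ext _ (fun f => (beta k)^-1%:MP *
    ((- 1) *: (poly_t (g k) * f) + A f))) => [f|].
  rewrite /A coefD !coefCM !coef0_taylor_s scaleN1r addKr mulrA -mpolyCM.
  by rewrite mulVf // mpolyC1 mul1r.
apply: (@slot_stable_comp _ (fun f => (beta k)^-1%:MP * f)
    (fun f => (-1) *: (poly_t (g k) * f) + A f)).
- exact: linear_mull.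
- exact: (linear_comb _ gl (Al k 0%N)).
- exact: slot_stable_mul.
apply: (slot_stable_comb _ gl (Al k 0%N)); first exact: slot_stable_mul.
apply: (@slot_stable_coef (fun k f => q k * taylor_s f + b k * taylor_s (partial_t f)) gb) => // j n f.
rewrite hornerD !hornerM !horner_taylor_s !hornerC /= scalerDr mul_mpolyC scalerA.
by rewrite partial_t_shift.
Qed.

End WeylStable.

(** * The proper submodule when two of the lambda_k coincide *)

(** A shift commutes with every ingredient of the action except multiplication by s, which it turns
    into multiplication by s - i. Only L_n therefore yields an extra term. *)
Lemma shift_op k x n i f : shift i (op k x n f) =
  (if x is gL then - (i%:~R * lambda k ^ n) else 0) *: shift (i + n) f
  + op k x n (shift i f).
Proof.
have shiftZ a (p : P) : shift i (a *: p) = a *: shift i p.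
  by rewrite -!mul_mpolyC shiftM shiftC.
have pts (p : P) : shift i (partial_t (shift n p)) = partial_t (shift n (shift i p)).
  by rewrite -partial_t_shift !shift_shift [n + i]addrC.
have ss (p : P) : shift i (shift n p) = shift n (shift i p).
  by rewrite !shift_shift [n + i]addrC.
have shiftN (p : P) : shift i (- p) = - shift i p by rewrite -scaleN1r shiftZ scaleN1r.
case: x => /=; rewrite ?(shiftN, shiftD, shiftZ, shiftM, shift_s, shift_t,
  shift_poly_t, shiftC) ?(pts, ss) ?scale0r ?add0r //.
rewrite -shift_shift ss; move: (shift n _) => h.
rewrite [_ - _]addrC -addrA mulrDl scalerDr; congr (_ + _).
by rewrite mulNr scalerN scaleNr mul_mpolyC !scalerA mulrC.
Qed.

Lemma slot_shift_act i x n l (w : T) :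
  slot i (@shift C l) (\sum_k slot k (op k x n) w) =
  (if x is gL then - (l%:~R * lambda i ^ n) else 0) *: slot i (@shift C (l + n)) w
  + \sum_k slot k (op k x n) (slot i (@shift C l) w).
Proof.
have sl l' := @shift_linear C l'.
have opl k := op_linear k x n.
rewrite slot_sum; last exact: sl.
rewrite (bigD1 i) //= [in RHS](bigD1 i) //= addrA; congr (_ + _); last first.
  by apply: eq_bigr => k ki; rewrite (slot_comm _ (sl l) (opl k)) // eq_sym.
rewrite (slot_comp i (sl l) (opl i)) (slot_comp i (opl i) (sl l)).
rewrite -(slot_comb i _ (sl (l + n))); last by move=> a p q; rewrite sl opl.
by congr (slot _ _ w); apply/funext => f; apply: shift_op.
Qed.

(** These are the polynomials that depend on s_j and s_k only through s_j + s_k. *)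
Definition shift_invariants j k (w : T) :=
  forall n, slot j (@shift C n) w = slot k (@shift C n) w.

Lemma shift_invariants_subspace j k : subspace (shift_invariants j k).
Proof.
split=> [n|a s t Ws Wt n]; first by rewrite !slot0r //; apply: shift_linear.
by rewrite !slot_linear; [rewrite Ws Wt|exact: shift_linear|exact: shift_linear].
Qed.

(** By [slot_shift_act], the two shifted vectors differ only by exchanging lambda_j with lambda_k
    and the slot-j shifts of w, by l and by l + n, with the slot-k ones. *)
Lemma shift_invariants_stable j k : lambda j = lambda k ->
  basis_stable (shift_invariants j k).
Proof. by move=> ljk x n w Ww l; rewrite !slot_shift_act ljk !Ww. Qed.

Lemma upd_one i : upd (one_fam) i 1 = one_fam.
Proof. by rewrite -[RHS](upd_id _ i) ffunE. Qed.

Lemma shift1 n : shift n 1 = 1 :> P.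
Proof. by rewrite -mpolyC1 shiftC. Qed.

Lemma shift_invariants_one j k : shift_invariants j k (pure (one_fam)).
Proof.
move=> n; have slot1 i : slot i (@shift C n) (pure (one_fam)) = pure (one_fam).
  by rewrite (slot_pure i (@shift_linear C n)) ffunE shift1 upd_one.
by rewrite !slot1.
Qed.

Lemma shift_invariants_proper j k : j != k -> ~ forall w, shift_invariants j k w.
Proof.
(* The witness is s_j: shifting by 1 in slot j subtracts 1 (x) ... (x) 1 from it, while shifting in
   slot k fixes it. *)
move=> jk /(_ (pure (upd (one_fam) j (var_s C))) 1).
have sl := @shift_linear C 1; rewrite (slot_pure j sl) (slot_pure k sl).
rewrite updE upd_upd.
have s1 : upd (one_fam) j (var_s C) k = 1 by rewrite updNE // ffunE.
have := upd_id (upd (one_fam) j (var_s C)) k; rewrite s1 shift1 => ->.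
rewrite shift_s [_ - _]addrC -[- _]scaleN1r pure_lin mpolyC1 upd_one.
move/eqP; rewrite -[X in _ == X]add0r (inj_eq (addIr _)) scaler_eq0 oppr_eq0 oner_eq0 /=.
by rewrite (negbTE (pure_one_neq0)).
Qed.

Lemma omega_tensor_simple :
  simple_module (omega_tensor alpha beta gamma lambda g hbeta hlambda) <->
  forall j k : 'I_m, j != k -> lambda j != lambda k.
Proof.
split=> [[_ simple] j k jk|hdiff].
  apply/eqP => ljk.
  have [|W0|WT] := simple (shift_invariants j k).
  - apply/submoduleP; split; first exact: shift_invariants_subspace.
    exact: shift_invariants_stable.
  - have := W0 _ (shift_invariants_one j k); apply/eqP; exact: pure_one_neq0.
  - exact: (shift_invariants_proper jk WT).
split=> [|W]; first by exists (pure (one_fam)); apply: pure_one_neq0.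
move/submoduleP => [W_sub W_stable].
apply: (weyl_stable_trivial W_sub) => k.
- by move=> p; apply: (slot_stable_mul W_sub W_stable hdiff).
- exact: (slot_stable_partial_s W_sub W_stable hdiff).
- exact: (slot_stable_partial_t W_sub W_stable hdiff).
Qed.

End Action.

End PolynomialTensors.

Theorem theorem4p4 (R : realType) (m : nat) (hm : (0 < m)%N)
    (alpha beta gamma lambda : 'I_m -> R[i]) (g : 'I_m -> {poly R[i]})
    (hbeta : forall k, beta k != 0) (hlambda : forall k, lambda k != 0) :
  simple_module (omega_tensor alpha beta gamma lambda g hbeta hlambda) <->
    (forall j k : 'I_m, j != k -> lambda j != lambda k) /\
    (forall k : 'I_m, lambda k != 0).
Proof.
rewrite (omega_tensor_simple alpha gamma g hbeta hlambda).
by split=> [H|[]].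
Qed.
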